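(* Let $k \ge 4$ be a fixed integer. There exist a constant $c = c(k) > 0$ and an integer $n_0$ such that for every $n \ge n_0$, every $(n,k,k-2)$-omitting system has an independent set of size at least $c\, n^{2/(k-1)} (\log \log n)^{1/(k-1)}$. In other words, $g(n,k,k-2) = \Omega\left(n^{\frac{2}{k-1}} (\log\log n)^{\frac{1}{k-1}}\right)$.
   Context: A $k$-uniform hypergraph ($k$-graph) is a family of $k$-element subsets (edges) of a finite vertex set. A set of vertices is independent if it contains no edge; $\alpha(\mathcal{H})$ is the maximum size of an independent set. For integers $k > \ell \ge 1$, an $(n,k,\ell)$-omitting system is a $k$-graph on $n$ vertices with no two edges whose intersection has size exactly $\ell$. $g(n,k,\ell)$ denotes the minimum of $\alpha(\mathcal{H})$ over all $(n,k,\ell)$-omitting systems $\mathcal{H}$. Asymptotic notation is with respect to $n \to \infty$ with $k$ fixed. *)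

(* Defs.v *)
From mathcomp Require Import all_boot.

Set Implicit Arguments.
Unset Strict Implicit.
Unset Printing Implicit Defensive.

Section Hypergraph.
Variable T : finType.
Implicit Types (H : {set {set T}}) (S : {set T}).

Definition uniform (k : nat) H := [forall A in H, #|A| == k].

Definition independent H S := ~~ [exists A in H, A \subset S].

Definition alpha H : nat := \max_(S : {set T} | independent H S) #|S|.

Definition omitting_system (n k l : nat) H :=
  [&& #|T| == n, uniform k H &
      [forall A in H, forall B in H, (A != B) ==> (#|A :&: B| != l)]].

End Hypergraph.

Lemma omitting_system0 (n k l : nat) :
  omitting_system n k l (set0 : {set {set 'I_n}}).
Proof.
by rewrite /omitting_system card_ord eqxx /=; apply/andP; split;
  apply/forall_inP => A; rewrite inE.
Qed.

(* [set0] is only the starting point of the minimisation; it is legitimate by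
   [omitting_system0]. *)
Definition g (n k l : nat) : nat :=
  alpha [arg min_(H < (set0 : {set {set 'I_n}}) | omitting_system n k l H)
           alpha H].

Lemma g_spec (n k l : nat) :
  (exists2 H : {set {set 'I_n}}, omitting_system n k l H & g n k l = alpha H)
  /\ (forall H : {set {set 'I_n}}, omitting_system n k l H ->
        g n k l <= alpha H).
Proof.
rewrite /g; case: arg_minnP => [|H HP Hmin]; first exact: omitting_system0.
by split; [exists H | exact: Hmin].
Qed.

(* Main.v *)
Require Import Defs.
From mathcomp Require Import all_boot all_order all_algebra.
From mathcomp Require Import reals sequences exp.
From mathcomp Require Import zify ring lra.

(** In a [k]-graph omitting the intersection size [k - 2], "sharing at least
    [k - 2] vertices" is an equivalence relation on the edges: edges of one class
    share at least [k - 1] vertices, edges of different classes at most [k - 3].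
    Colour every edge with its class. A first-moment deletion argument applied to
    a random sample of about [n^(2/(k-1))] (up to a power of [log n]) vertices
    leaves a vertex set [A] in which the degrees are at most a power [d] of
    [log n] and in which no closed walk, along edges of distinct consecutive
    colours, has length at most [2 Q], where [Q] is a smaller power of [log n].

    On [A] every vertex gets a random round among [Q]. A vertex is accepted in its
    round unless some class blocks it, i.e. contains an edge all of whose other
    vertices were accepted earlier (or are processed in the same round); in this
    recursion the acceptance of the other vertices ignores the blocking class, so
    that by acyclicity all the events involved are independent. Vertices whose
    acceptance probability has reached [1/Q] are no longer accepted. Because of
    this cap a vertex stays unblocked with probability at least
    [exp(- 2 d (5/Q)^(k-1))], which exceeds [2/Q] if [d] is a small multiple of
    [Q^(k-1) log Q]; hence within [Q] rounds every vertex reaches the cap and the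
    accepted vertices form an independent set of expected size [|A|/Q]. The factor
    [log Q], of order [log log n], in the choice of [d] is the gain over the
    trivial bound. *)

Set Implicit Arguments.
Unset Strict Implicit.
Unset Printing Implicit Defensive.

Import Order.TTheory GRing.Theory Num.Theory.
Local Open Scope ring_scope.

(** * Finite sets and sums *)

Lemma leq_bin_exp n m : ('C(n, m) <= n ^ m)%N.
Proof.
apply: (@leq_trans (n ^_ m)); first by rewrite -bin_ffact leq_pmulr ?fact_gt0.
by elim: m => // m IH; rewrite ffactnSr expnSr leq_mul // leq_subr.
Qed.

Section FiniteSets.
Variables (I J T : finType).
Implicit Types (e f X Y : {set T}) (F : {set {set T}}).

Lemma sum_card_exchange (A : {set I}) (B : {set J}) (r : I -> J -> bool) :
  (\sum_(i in A) #|[set j in B | r i j]| =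
   \sum_(j in B) #|[set i in A | r i j]|)%N.
Proof.
under eq_bigr do rewrite -sum1dep_card.
under [RHS]eq_bigr do rewrite -sum1dep_card.
rewrite (exchange_big_dep (mem B)) /=; last by move=> i j _ /andP[].
by apply: eq_bigr => j jB; apply: eq_bigl => i; rewrite jB.
Qed.

Lemma mem_of_card_setI_pred e f x y :
  (#|e| <= #|e :&: f|.+1)%N -> x \in e -> y \in e -> x != y ->
  (x \in f) || (y \in f).
Proof.
move=> ef xe ye xy; apply: contra_neqT xy => /norP[xf yf].
have /card_le1_eqP eq_ef : (#|e :\: f| <= 1)%N by have := cardsID f e; lia.
by apply: eq_ef; rewrite inE ?xe ?ye ?xf ?yf.
Qed.

Lemma subset_card_pred X Y : X \subset Y -> (#|Y| <= #|X|.+1)%N ->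
  X = Y \/ exists2 y, y \in Y & X = Y :\ y.
Proof.
move=> XY cardY; have [YX|/subsetPn[y yY yX]] := boolP (Y \subset X).
  by left; apply/eqP; rewrite eqEsubset XY.
right; exists y => //; apply/eqP; rewrite eqEcard subsetD1 XY yX /=.
by have := cardsD1 y Y; rewrite yY; lia.
Qed.

Lemma exists_subset_card X Y m : X \subset Y -> (#|X| <= m <= #|Y|)%N ->
  exists S : {set T}, [/\ X \subset S, S \subset Y & #|S| = m].
Proof.
move=> XY /andP[Xm mY].
have cardD : #|Y :\: X| = (#|Y| - #|X|)%N by rewrite cardsD (setIidPr XY).
pose subs := [set S : {set T} | S \subset Y :\: X & #|S| == (m - #|X|)%N].
have /set0Pn[S] : subs != set0.
  by rewrite -card_gt0 cards_draws bin_gt0 cardD leq_sub2r.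
rewrite inE subsetD => /andP[/andP[SY dSX] /eqP cardS].
exists (X :|: S); rewrite subsetUl subUset XY SY; split=> //.
by rewrite cardsU setIC (disjoint_setI0 dSX) cards0 subn0 cardS subnKC.
Qed.

Lemma exists_hitting_set F : set0 \notin F ->
  exists2 B : {set T}, (#|B| <= #|F|)%N & {in F, forall W, W :&: B != set0}.
Proof.
move=> F0; pose rep (W : {set T}) := [pick x in W].
exists [set x | Some x \in rep @: F].
  have Some_inj : injective (@Some T) by move=> x y [].
  apply: leq_trans (leq_imset_card rep F).
  rewrite -(card_imset _ Some_inj) subset_leq_card //.
  by apply/subsetP => _ /imsetP[x + ->]; rewrite inE.
move=> W WF; have := imset_f rep WF; rewrite {1}/rep.
case: pickP => [x xW xF | W0 _].
  by apply/set0Pn; exists x; rewrite !inE xW.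
by case/negP: F0; rewrite (_ : set0 = W) //; apply/setP => x; rewrite inE W0.
Qed.

End FiniteSets.

Section Sums.
Variables (R : numDomainType) (I J : finType).

Lemma natr_card_sep (A : {set I}) (P : pred I) :
  #|[set i in A | P i]|%:R = \sum_(i in A) (P i)%:R :> R.
Proof.
rewrite -sum1dep_card natr_sum big_mkcondr; apply: eq_bigr => i _.
by case: (P i).
Qed.

Lemma ler_sum_setU (A B : {set I}) (f : I -> R) : (forall i, 0 <= f i) ->
  \sum_(i in A :|: B) f i <= \sum_(i in A) f i + \sum_(i in B) f i.
Proof.
move=> f0; rewrite (big_setID A) /= setUK lerD2l setDUl setDv set0U.
by rewrite [leRHS](big_setID A) /= lerDr sumr_ge0.
Qed.

Lemma ler_sum_bigcup (P : pred J) (A : J -> {set I}) (f : I -> R) :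
  (forall i, 0 <= f i) ->
  \sum_(i in \bigcup_(j | P j) A j) f i <= \sum_(j | P j) \sum_(i in A j) f i.
Proof.
move=> f0; elim/big_rec2: _ => [|j x B _ IH]; first by rewrite big_set0.
by apply: le_trans (ler_sum_setU _ _ f0) _; rewrite lerD2l.
Qed.

Lemma ler_sum_imset (D : {set I}) (h : I -> J) (f : J -> R) :
  (forall j, 0 <= f j) -> \sum_(j in h @: D) f j <= \sum_(i in D) f (h i).
Proof.
move=> f0; rewrite [leRHS](partition_big_imset h).
apply: ler_sum => _ /imsetP[i iD ->].
by rewrite (bigD1 i) ?iD ?eqxx //= lerDl sumr_ge0.
Qed.

Lemma ler_sum_level (A : {set I}) (h : I -> nat) (m : nat) (P : pred nat)
    (f : I -> R) (b : R) :
  (forall i, 0 <= f i) -> 0 <= b -> (forall l, P l -> (l < m)%N) ->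
  (forall l, P l -> \sum_(i in A | h i == l) f i <= b) ->
  \sum_(i in A | P (h i)) f i <= m%:R * b.
Proof.
move=> f0 b0 Pm fb.
apply: (@le_trans _ _ (\sum_(l < m | P l) \sum_(i in A | h i == l) f i)).
  rewrite (exchange_big_dep (mem A)) /=; last by move=> l i _ /andP[].
  rewrite big_mkcondr; apply: ler_sum => i iA; case: ifP => [Pi|_].
    by rewrite (bigD1 (Ordinal (Pm _ Pi))) /= ?iA ?Pi ?eqxx // lerDl sumr_ge0.
  exact: sumr_ge0.
apply: (@le_trans _ _ (\sum_(l < m) b)); last first.
  by rewrite sumr_const card_ord mulr_natl.
by rewrite big_mkcond; apply: ler_sum => l _; case: ifP => // /fb.
Qed.

End Sums.

(** * Uniform hypergraphs and codegrees *)

Section Hypergraphs.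
Variable T : finType.
Implicit Types (H F : {set {set T}}) (A S : {set T}).

Lemma uniformP k H : reflect {in H, forall e : {set T}, #|e| = k} (uniform k H).
Proof. by apply: (iffP forall_inP) => Hk e /Hk/eqP. Qed.

Lemma uniformS k H F : F \subset H -> uniform k H -> uniform k F.
Proof. by move=> /subsetP FH /uniformP Hk; apply/uniformP => e /FH/Hk. Qed.

Lemma independent_induced H A S :
  S \subset A -> independent (H ::&: A) S -> independent H S.
Proof.
move=> SA; apply: contra => /exists_inP[e eH eS].
by apply/exists_inP; exists e; rewrite // inE eH (subset_trans eS).
Qed.

Definition codegree H S := #|[set e in H | S \subset e]|.

Definition degree H v := codegree H [set v].

Lemma codegreeS H F S : F \subset H -> (codegree F S <= codegree H S)%N.
Proof.
by move=> FH; apply/subset_leq_card/subsetP => e; rewrite !inE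
  => /andP[/(subsetP FH) -> ->].
Qed.

Lemma sum_codegree k i H : uniform k H ->
  (\sum_(S in [set S : {set T} | #|S| == i]) codegree H S = 'C(k, i) * #|H|)%N.
Proof.
move=> /uniformP Hk; rewrite sum_card_exchange mulnC -sum_nat_const.
apply: eq_bigr => e /Hk <-; rewrite -cards_draws; apply: eq_card => S.
by rewrite !inE andbC.
Qed.

Lemma card_large_codegree (R : numDomainType) k i H (x : R) : uniform k H ->
  #|[set S : {set T} | #|S| == i & x < (codegree H S)%:R]|%:R * x
    <= ('C(k, i) * #|H|)%:R.
Proof.
move=> Hk; rewrite -(sum_codegree i Hk) natr_sum mulr_natl -sumr_const.
rewrite [leRHS](big_setID [set S : {set T} | x < (codegree H S)%:R]) /=.
rewrite (_ : _ :&: _ = [set S : {set T} | #|S| == i & x < (codegree H S)%:R]).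
  rewrite -[leLHS]addr0 lerD ?sumr_ge0 ?ler_sum // => S.
  by rewrite inE => /andP[_ /ltW].
by apply/setP => S; rewrite !inE.
Qed.

Lemma card_large_degree (R : numDomainType) k H (x : R) : uniform k H ->
  #|[set v | x < (degree H v)%:R]|%:R * x <= (k * #|H|)%:R.
Proof.
move=> /(card_large_codegree 1 x); rewrite bin1.
rewrite (_ : [set S | _ & _] = set1 @: [set v | x < (degree H v)%:R]).
  by rewrite card_imset //; exact: set1_inj.
apply/setP => S; rewrite inE; apply/andP/imsetP => [[/cards1P[v ->]]|[v + ->]].
  by exists v; rewrite ?inE.
by rewrite inE cards1.
Qed.

End Hypergraphs.

(** * Product measures on finite function spaces *)

Section ProductMean.
Variables (R : realFieldType) (T S : finType) (mu : S -> R).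
Hypothesis mu_ge0 : forall s, 0 <= mu s.
Hypothesis sum_mu : \sum_s mu s = 1.
Local Notation Omega := {ffun T -> S}.
Implicit Types (A B : {set T}) (t : Omega) (f g : Omega -> R).

Definition mean f : R := \sum_(t : Omega) (\prod_v mu (t v)) * f t.

Definition depends_on A (X : Type) (f : Omega -> X) :=
  forall t t', {in A, t =1 t'} -> f t = f t'.

Lemma depends_on_sub A B X (f : Omega -> X) :
  A \subset B -> depends_on A f -> depends_on B f.
Proof. by move=> /subsetP AB fA t t' tt'; apply: fA => v /AB/tt'. Qed.

Lemma depends_on_comp A X Y (g : X -> Y) (f : Omega -> X) :
  depends_on A f -> depends_on A (g \o f).
Proof. by move=> fA t t' /fA /= ->. Qed.

Lemma depends_on_prod (I : eqType) (r : seq I) A (f : I -> Omega -> R) :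
  {in r, forall i, depends_on A (f i)} ->
  depends_on A (fun t => \prod_(i <- r) f i t).
Proof.
by move=> fA t t' tt'; rewrite !big_seq; apply: eq_bigr => i /fA; apply.
Qed.

Lemma eq_mean f g : f =1 g -> mean f = mean g.
Proof. by move=> fg; apply: eq_bigr => t _; rewrite fg. Qed.

Lemma meanD f g : mean (fun t => f t + g t) = mean f + mean g.
Proof. by rewrite -big_split; apply: eq_bigr => t _; rewrite mulrDr. Qed.

Lemma meanZ a f : mean (fun t => a * f t) = a * mean f.
Proof. by rewrite mulr_sumr; apply: eq_bigr => t _; rewrite mulrCA. Qed.

Lemma meanB f g : mean (fun t => f t - g t) = mean f - mean g.
Proof.
by rewrite -mulN1r -meanZ -meanD; apply: eq_mean => t; rewrite mulN1r.
Qed.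

Lemma mean_sum (I : Type) (r : seq I) (P : pred I) (F : I -> Omega -> R) :
  mean (fun t => \sum_(i <- r | P i) F i t) = \sum_(i <- r | P i) mean (F i).
Proof. by rewrite exchange_big; apply: eq_bigr => t _; rewrite mulr_sumr. Qed.

Let prod_mu_ge0 t : 0 <= \prod_v mu (t v).
Proof. exact: prodr_ge0. Qed.

Lemma le_mean f g : (forall t, f t <= g t) -> mean f <= mean g.
Proof. by move=> fg; apply: ler_sum => t _; rewrite ler_wpM2l. Qed.

Lemma mean_ge0 f : (forall t, 0 <= f t) -> 0 <= mean f.
Proof. by move=> f0; apply: sumr_ge0 => t _; rewrite mulr_ge0. Qed.

Lemma mean_prod_coord (f : T -> S -> R) :
  mean (fun t => \prod_v f v (t v)) = \prod_v \sum_s mu s * f v s.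
Proof.
by rewrite bigA_distr_bigA; apply: eq_bigr => t _; rewrite big_split.
Qed.

Lemma mean_cst (a : R) : mean (fun=> a) = a.
Proof.
rewrite -[a in LHS]mulr1 meanZ -[RHS]mulr1; congr (_ * _).
transitivity (mean (fun t => \prod_(v : T) 1)).
  by apply: eq_mean => t; rewrite big1.
rewrite (mean_prod_coord (fun _ _ => 1)) big1 // => v _.
by under eq_bigr do rewrite mulr1.
Qed.

Lemma mean_forall A (P : pred S) :
  mean (fun t => [forall v in A, P (t v)]%:R) = (\sum_(s | P s) mu s) ^+ #|A|.
Proof.
transitivity (mean (fun t => \prod_v (if v \in A then (P (t v))%:R else 1))).
  apply: eq_mean => t; rewrite -big_mkcond; apply/esym.
  case: (boolP [forall v in A, _]) => [/forall_inP Pt|].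
    by rewrite big1 // => v /Pt ->.
  by case/forall_inPn=> v vA /negbTE Pt; rewrite (bigD1 v) //= Pt mul0r.
rewrite (mean_prod_coord (fun v s => if v \in A then (P s)%:R else 1)).
rewrite -prodr_const [RHS]big_mkcond; apply: eq_bigr => v _.
case: ifP => _; last by under eq_bigr do rewrite mulr1.
rewrite [RHS]big_mkcond; apply: eq_bigr => s _.
by case: (P s); rewrite ?mulr1 ?mulr0.
Qed.

Lemma mean_coord_eq (v : T) (s : S) : mean (fun t => (t v == s)%:R) = mu s.
Proof.
rewrite -[RHS]expr1 -(cards1 v) -[mu s](big_pred1_eq +%R) -mean_forall.
apply: eq_mean => t; congr _%:R; congr nat_of_bool.
by apply/idP/forall_inP => [tv w /set1P ->|->] //; rewrite ?set11.
Qed.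

Lemma exists_ge_mean f : exists t, mean f <= f t.
Proof.
apply/existsP/existsPn => f_lt.
have gap_ge0 t : 0 <= (\prod_v mu (t v)) * (mean f - f t).
  by rewrite mulr_ge0 // subr_ge0 ltW // ltNge f_lt.
have gap0 : mean (fun t => mean f - f t) = 0 by rewrite meanB mean_cst subrr.
have prod_mu0 t : \prod_v mu (t v) = 0.
  have := psumr_eq0P (fun t _ => gap_ge0 t) gap0 (i := t) isT => /eqP.
  rewrite mulf_eq0 => /orP[/eqP //|].
  by rewrite subr_eq0 gt_eqF // ltNge f_lt.
have := mean_cst 1; rewrite /mean big1 => [/esym/eqP|t _].
  by rewrite oner_eq0.
by rewrite prod_mu0 mul0r.
Qed.

(* Exchanging the coordinates in [A] of two independent copies is a
   measure-preserving involution of the pairs. *)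
Lemma mean_mul_disjoint A B f g :
  depends_on A f -> depends_on B g -> [disjoint A & B] ->
  mean (fun t => f t * g t) = mean f * mean g.
Proof.
move=> fA gB AB; pose P t : R := \prod_v mu (t v).
pose mix t t' : Omega := [ffun v => if v \in A then t v else t' v].
pose swap (x : Omega * Omega) := (mix x.1 x.2, mix x.2 x.1).
have swapK : involutive swap.
  case=> t t'; rewrite /swap /=; congr pair; apply/ffunP => v; rewrite !ffunE;
  by case: ifP => // ->.
have P_mix t t' : P (mix t t') * P (mix t' t) = P t * P t'.
  rewrite /P -!big_split; apply: eq_bigr => v _ /=; rewrite !ffunE.
  by case: ifP => // _; rewrite mulrC.
transitivity (\sum_t \sum_t' P t * P t' * (f t * g t)).
  have <- :
      \sum_t P t * (f t * g t) * mean (fun=> 1) = mean (fun t => f t * g t).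
    by rewrite -mulr_suml mean_cst mulr1.
  apply: eq_bigr => t _; rewrite /mean mulr_sumr; apply: eq_bigr => t' _.
  by rewrite mulr1 -/(P t') mulrAC.
have -> : mean f * mean g = \sum_t \sum_t' P t * P t' * (f t * g t').
  rewrite /mean mulr_suml; apply: eq_bigr => t _; rewrite mulr_sumr.
  by apply: eq_bigr => t' _; rewrite -/(P t) -/(P t'); ring.
rewrite !pair_big /= [RHS](reindex_inj (inv_inj swapK)).
apply: eq_bigr => -[t t'] _ /=; rewrite P_mix; congr (_ * (_ * _)).
  by apply: fA => v vA; rewrite ffunE vA.
by apply: gB => v vB; rewrite ffunE (disjointFl AB).
Qed.

Lemma mean_prod_seq (I : finType) (r : seq I) (D : I -> {set T})
    (f : I -> Omega -> R) :
  uniq r -> {in r, forall i, depends_on (D i) (f i)} ->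
  {in r &, forall i j, i != j -> [disjoint D i & D j]} ->
  mean (fun t => \prod_(i <- r) f i t) = \prod_(i <- r) mean (f i).
Proof.
elim: r => [|i r IH] /= => [_ _ _|/andP[ir ur] fD DD].
  by rewrite big_nil -[RHS](mean_cst 1); apply: eq_mean => t; rewrite big_nil.
rewrite big_cons -IH //; last 2 first.
- by move=> j jr; apply: fD; rewrite inE jr orbT.
- by move=> j j' jr jr'; apply: DD; rewrite inE ?jr ?jr' orbT.
rewrite -(mean_mul_disjoint (A := D i) (B := \bigcup_(j in r) D j)).
- by apply: eq_mean => t; rewrite big_cons.
- by apply: fD; rewrite mem_head.
- apply: depends_on_prod => j jr; apply: depends_on_sub (bigcup_sup j jr) _.
  by apply: fD; rewrite inE jr orbT.
- apply: bigcup_disjoint => j jr; apply: DD;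
    rewrite ?mem_head // ?inE ?jr ?orbT //.
  by apply: contraNneq ir => ->.
Qed.

Lemma mean_prod (I : finType) (P : pred I) (D : I -> {set T})
    (f : I -> Omega -> R) :
  (forall i, P i -> depends_on (D i) (f i)) ->
  (forall i j, P i -> P j -> i != j -> [disjoint D i & D j]) ->
  mean (fun t => \prod_(i | P i) f i t) = \prod_(i | P i) mean (f i).
Proof.
move=> fD DD; rewrite -big_filter -(@mean_prod_seq _ _ D).
- by apply: eq_mean => t; rewrite -big_filter.
- by rewrite filter_uniq ?index_enum_uniq.
- by move=> i; rewrite mem_filter => /andP[/fD].
- by move=> i j; rewrite !mem_filter => /andP[Pi _] /andP[Pj _]; apply: DD.
Qed.

End ProductMean.

(** * Properly coloured walks in edge-coloured hypergraphs *)

Section Walks.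
Variables (T K : finType) (H : {set {set T}}) (c : {set T} -> K).
Local Open Scope nat_scope.
Implicit Types (e : {set T}) (es : nat -> {set T}) (vs : nat -> T).
Implicit Types (u y : T) (C : option K) (D : K).

Definition proper_walk L es vs : Prop :=
  (forall i, i < L ->
     [/\ es i \in H, vs i \in es i, vs i.+1 \in es i & vs i != vs i.+1]) /\
  (forall i, i.+1 < L -> c (es i) != c (es i.+1)).

Definition acyclic_upto M : Prop :=
  forall L es vs, 0 < L <= M -> proper_walk L es vs -> vs 0 != vs L.

Definition fcons X (x : X) (f : nat -> X) i := if i is i'.+1 then f i' else x.

Lemma proper_walk_cons e u L es vs :
  proper_walk L es vs -> e \in H -> u \in e -> vs 0 \in e -> u != vs 0 ->
  (0 < L -> c (es 0) != c e) -> proper_walk L.+1 (fcons e es) (fcons u vs).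
Proof.
move=> [w colors] eH ue ve uv ce; split=> [[|i] //= iL|[|i] //= iL].
- exact: w.
- by rewrite eq_sym ce.
- exact: colors.
Qed.

Lemma proper_walk_rev L es vs : proper_walk L es vs ->
  proper_walk L (fun i => es (L.-1 - i)) (fun i => vs (L - i)).
Proof.
move=> [w colors]; split=> i iL.
  have /w[? ? ? ?] : L.-1 - i < L by lia.
  have <- : (L.-1 - i).+1 = L - i by lia.
  by have <- : L.-1 - i = L - i.+1; [lia | rewrite eq_sym].
have -> : L.-1 - i = (L.-1 - i.+1).+1 by lia.
by rewrite eq_sym colors //; lia.
Qed.

Lemma proper_walk_cat L1 es1 vs1 L2 es2 vs2 :
  proper_walk L1 es1 vs1 -> proper_walk L2 es2 vs2 -> vs1 L1 = vs2 0 ->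
  (0 < L1 -> 0 < L2 -> c (es1 L1.-1) != c (es2 0)) ->
  proper_walk (L1 + L2) (fun i => if i < L1 then es1 i else es2 (i - L1))
                        (fun i => if i < L1 then vs1 i else vs2 (i - L1)).
Proof.
move=> [w1 colors1] [w2 colors2] ends c12; split=> i iL.
  case: (ltnP i L1) => iL1.
    have [? ? ? ?] := w1 _ iL1; case: ltnP => // L1i.
    have last_i : i.+1 = L1 by lia.
    by have -> : i.+1 - L1 = 0; [lia | rewrite -ends -last_i].
  rewrite ltnNge (leq_trans iL1 (leqnSn i)) /= subSn //.
  by apply: w2; lia.
case: (ltnP i L1) => iL1.
  case: ltnP => L1i; first exact: colors1.
  have -> : i.+1 - L1 = 0 by lia.
  by have -> : i = L1.-1; [lia | apply: c12; lia].
rewrite ltnNge (leq_trans iL1 (leqnSn i)) /= subSn //.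
by apply: colors2; lia.
Qed.

Lemma acyclic_first_color M L1 es1 vs1 L2 es2 vs2 : acyclic_upto M ->
  proper_walk L1 es1 vs1 -> proper_walk L2 es2 vs2 ->
  vs1 0 = vs2 0 -> vs1 L1 = vs2 L2 -> 0 < L1 + L2 <= M ->
  [/\ 0 < L1, 0 < L2 & c (es1 0) = c (es2 0)].
Proof.
move=> acyclicM w1 w2 starts ends LM.
have [/and3P[? ? /eqP] //|c12] :=
  boolP [&& 0 < L1, 0 < L2 & c (es1 0) == c (es2 0)].
have [||] := proper_walk_cat (proper_walk_rev w1) w2; rewrite ?subnn //.
  by move=> L1_gt0 L2_gt0; move: c12; rewrite L1_gt0 L2_gt0.
move=> closed1 closed2.
have := acyclicM _ _ _ LM (conj closed1 closed2).
rewrite addKn subn0 [L1 + L2 < L1]ltnNge leq_addr /=.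
case: (posnP L1) => [L10|_]; last by rewrite ends eqxx.
by rewrite sub0n -starts -ends L10 eqxx.
Qed.

Fixpoint reach j u C : {set T} :=
  if j is j'.+1 then
    u |: \bigcup_(e in H | (u \in e) && (Some (c e) != C))
            \bigcup_(u' in e :\ u) reach j' u' (Some (c e))
  else [set u].

Definition branch j u D : {set T} :=
  \bigcup_(e in H | (u \in e) && (c e == D))
     \bigcup_(u' in e :\ u) reach j u' (Some D).

Lemma mem_reach j u C : u \in reach j u C.
Proof. by case: j => [|j]; rewrite /= !inE eqxx. Qed.

Lemma reach_subS j u C : reach j u C \subset reach j.+1 u C.
Proof.
elim: j u C => [|j IH] u C; first by rewrite /= subsetUl.
rewrite [reach j.+2 u C]/= [reach j.+1 u C]/=.
apply: setUS; apply/bigcupsP => e eH; apply: (bigcup_max e) => //.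
apply/bigcupsP => v ve; apply: (bigcup_max v) => //; exact: IH.
Qed.

Lemma branch_sub_reach j u C D : Some D != C ->
  branch j u D \subset reach j.+1 u C.
Proof.
move=> DC; apply/bigcupsP => e /andP[eH /andP[ue /eqP ce]].
rewrite /= subsetU //; apply/orP; right.
by apply: (bigcup_max e); rewrite ?eH ?ue ?ce.
Qed.

Lemma reach_sub_branch j e u v : e \in H -> u \in e -> v \in e :\ u ->
  reach j v (Some (c e)) \subset branch j u (c e).
Proof.
by move=> eH ue ve; apply: (bigcup_max e);
  [rewrite eH ue eqxx | exact: (bigcup_sup v)].
Qed.

Lemma reachP j u C y : y \in reach j u C ->
  exists L es vs, [/\ L <= j, proper_walk L es vs, vs 0 = u, vs L = y &
    0 < L -> Some (c (es 0)) != C].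
Proof.
have empty_walk u' C' y' : y' = u' -> exists L es vs, [/\ L <= 0,
    proper_walk L es vs, vs 0 = u', vs L = y' & 0 < L -> Some (c (es 0)) != C'].
  by move=> ->; exists 0, (fun=> set0), (fun=> u').
elim: j u C => [|j IH] u C /=; first by rewrite inE => /eqP /empty_walk.
rewrite !inE => /orP[/eqP/empty_walk|].
  by move=> /(_ C)[L [es [vs [L0 ? ? ? ?]]]]; exists L, es, vs; split=> //; lia.
case/bigcupP=> e /and3P[eH ue ce] /bigcupP[u']; rewrite !inE => /andP[u'u u'e].
case/IH=> L [es [vs [Lj walk v0 vL cL]]].
exists L.+1, (fcons e es), (fcons u vs); split=> //.
by apply: proper_walk_cons; rewrite ?v0 // eq_sym //.
Qed.

Lemma branchP j u D y : y \in branch j u D ->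
  exists L es vs, [/\ 0 < L <= j.+1, proper_walk L es vs, vs 0 = u, vs L = y &
    c (es 0) = D].
Proof.
case/bigcupP=> e /and3P[eH ue /eqP ce] /bigcupP[u'].
rewrite !inE => /andP[u'u u'e] /reachP[L [es [vs [Lj walk v0 vL cL]]]].
exists L.+1, (fcons e es), (fcons u vs); split=> //.
apply: proper_walk_cons; rewrite ?v0 // 1?eq_sym //.
by move=> /cL; rewrite ce; apply: contra => /eqP ->.
Qed.

Variable M : nat.
Hypothesis acyclicM : acyclic_upto M.

Lemma branch_disjoint j u D1 D2 : (j.+1).*2 <= M -> D1 != D2 ->
  [disjoint branch j u D1 & branch j u D2].
Proof.
move=> jM D12; apply/pred0P => y /=; apply/negP => /andP[].
move=> /branchP[L1 [es1 [vs1 [L1j w1 start1 end1 color1]]]].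
move=> /branchP[L2 [es2 [vs2 [L2j w2 start2 end2 color2]]]].
have [||| _ _ same_color] := acyclic_first_color acyclicM w1 w2.
- by rewrite start1 start2.
- by rewrite end1 end2.
- lia.
by rewrite -color1 -color2 same_color eqxx in D12.
Qed.

Lemma root_notin_branch j u D : j.+1 <= M -> u \notin branch j u D.
Proof.
move=> jM; apply/negP => /branchP[L [es [vs [L0 walk v0 vL _]]]].
have LM : 0 < L <= M by lia.
by have := acyclicM LM walk; rewrite v0 vL eqxx.
Qed.

Lemma reach_disjoint j e u1 u2 : (j.+1).*2 <= M -> e \in H ->
  u1 \in e -> u2 \in e -> u1 != u2 ->
  [disjoint reach j u1 (Some (c e)) & reach j u2 (Some (c e))].
Proof.
move=> jM eH u1e u2e u12; apply/pred0P => y /=; apply/negP => /andP[].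
move=> /reachP[L1 [es1 [vs1 [L1j w1 start1 end1 color1]]]].
move=> /reachP[L2 [es2 [vs2 [L2j w2 start2 end2 color2]]]].
have w2' : proper_walk L2.+1 (fcons e es2) (fcons u1 vs2).
  by apply: proper_walk_cons; rewrite ?start2.
have [|||/color1/eqP color_neq _ same_color] :=
  acyclic_first_color acyclicM w1 w2' => //=.
- by rewrite end1 end2.
- lia.
by case: color_neq; rewrite same_color.
Qed.

End Walks.

(** * The random greedy process *)

Lemma expR_le_1Bx (R : realType) (b x : R) :
  0 <= x -> b <= x -> b <= 2^-1 -> expR (- (2 * x)) <= 1 - b.
Proof.
move=> x0 bx b2; rewrite expRN; have ge1 := expR_ge1Dx (2 * x).
have [x2|x2] := lerP x 2^-1.
  apply: (@le_trans _ _ (1 + 2 * x)^-1).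
    by rewrite lef_pV2 ?posrE ?expR_gt0 //; lra.
  by rewrite -[leLHS]mul1r ler_pdivrMr; [nra|lra].
apply: (@le_trans _ _ 2^-1); last lra.
by rewrite lef_pV2 ?posrE ?expR_gt0 //; lra.
Qed.

Section Greedy.
Variables (R : realType) (T K : finType) (H : {set {set T}}).
Variables (c : {set T} -> K) (k Q : nat).
Hypothesis Q_ge20 : (20 <= Q)%N.
Hypothesis k_ge3 : (3 <= k)%N.
Hypothesis H_unif : uniform k H.
Hypothesis meet_class :
  {in H &, forall e f : {set T}, c e = c f -> (k - 1 <= #|e :&: f|)%N}.
Hypothesis H_acyclic : acyclic_upto H c Q.*2.

Local Notation Omega := {ffun T -> 'I_Q}.
Implicit Types (e : {set T}) (u v : T) (C : option K) (D : K) (t : Omega).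
Implicit Type X : T -> option K -> Omega -> bool.

Local Notation unif := (fun _ : 'I_Q => Q%:R^-1 : R).
Local Notation mean := (mean unif).

Let Q_gt0 : 0 < Q%:R :> R. Proof. by rewrite ltr0n (leq_trans _ Q_ge20). Qed.
Let unif_ge0 i : 0 <= unif i. Proof. by rewrite invr_ge0 ler0n. Qed.
Let sum_unif : \sum_i unif i = 1.
Proof. by rewrite sumr_const card_ord -[_ *+ _]mulr_natr mulVf ?gt_eqF. Qed.

Let card_edgeD1 e u : e \in H -> u \in e -> #|e :\ u| = (k - 1)%N.
Proof.
by move=> eH ue; rewrite -(uniformP _ _ H_unif e eH) (cardsD1 u e) ue addKn.
Qed.

Definition occupied X j D v t := X v (Some D) t || (t v == j :> nat).

Definition blocked X j u D t :=
  [exists e in H, [&& u \in e, c e == D &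
     [forall v in e :\ u, occupied X j D v t]]].

Definition uncapped X u := mean (fun t => (X u None t)%:R) <= Q%:R^-1.

(* [accepted j u (Some D) t] says that [u] is accepted before round [j] when the
   constraints of the colour [D] are ignored at [u]; vertices are processed at
   the round [t u], and stop being accepted when their acceptance probability
   reaches the cap of [uncapped]. *)
Fixpoint accepted j u C t : bool :=
  if j is i.+1 then
    accepted i u C t || [&& t u == i :> nat, uncapped (accepted i) u &
      [forall D, (Some D != C) ==> ~~ blocked (accepted i) i u D t]]
  else false.

Lemma accepted_mono i j u C t : (i <= j)%N -> accepted i u C t ->
  accepted j u C t.
Proof.
move=> /subnK <-; elim: (j - i)%N => // m IH /IH acc.
by rewrite addSn /= acc.
Qed.

Lemma acceptedP j u C t : accepted j u C t ->
  [/\ (t u < j)%N, uncapped (accepted (t u)) u &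
      forall D, Some D != C -> ~~ blocked (accepted (t u)) (t u) u D t].
Proof.
elim: j => [//|j IH] /= /orP[/IH[]|/and3P[/eqP tj act /forallP nb]].
  by move=> tj ? ?; split=> //; exact: ltnW.
by rewrite tj; split=> // D; apply/implyP.
Qed.

Lemma accepted_own_round j u C t : accepted j u None t ->
  accepted (t u).+1 u C t.
Proof.
case/acceptedP=> tj act nb /=; apply/orP; right; rewrite eqxx act /=.
by apply/forallP => D; rewrite nb ?implybT.
Qed.

(* An accepted edge would block its vertex that is processed last. *)
Lemma accepted_independent j t : independent H [set u | accepted j u None t].
Proof.
apply/negP => /exists_inP[e eH /subsetP e_acc].
have {}e_acc v : v \in e -> accepted j v None t by move=> /e_acc; rewrite inE.
have [v0 v0e] : exists v, v \in e.
  by apply/card_gt0P; rewrite (uniformP _ _ H_unif) // (leq_trans _ k_ge3).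
case: (@arg_maxnP _ v0 (mem e) (fun v => t v) v0e) => u /= ue u_last.
have [_ _ /(_ (c e) isT)/negP] := acceptedP (e_acc u ue); apply.
apply/exists_inP; exists e => //; rewrite ue eqxx /=.
apply/forall_inP => v; rewrite /occupied !inE => /andP[vu ve].
have := u_last v ve; rewrite /= leq_eqVlt => /orP[->|lt]; first by rewrite orbT.
by rewrite (accepted_mono lt (accepted_own_round _ (e_acc v ve))).
Qed.

Lemma depends_on_blocked j u D :
  (forall v C, depends_on (reach H c j v C) (accepted j v C)) ->
  depends_on (branch H c j u D) (blocked (accepted j) j u D).
Proof.
move=> acc_dep t t' tt'; apply: eq_existsb => e; case eH: (e \in H) => //=.
case ue: (u \in e) => //=; case: eqP => //= ce.
apply: eq_forallb => v; case: (boolP (v \in e :\ u)) => //= ve.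
have := reach_sub_branch c j eH ue ve; rewrite ce => /subsetP sub.
rewrite /occupied (acc_dep v (Some D) t t') => [|w /sub]; last exact: tt'.
by rewrite tt' // sub // mem_reach.
Qed.

Lemma depends_on_accepted j u C : depends_on (reach H c j u C) (accepted j u C).
Proof.
elim: j u C => [//|j IH] u C t t' tt' /=.
rewrite (IH u C t t') => [|v /(subsetP (reach_subS _ _ _ _ _))/tt' //].
rewrite (tt' u) ?mem_reach //; congr (_ || [&& _, _ & _]).
apply: eq_forallb => D; case DC: (Some D != C) => //=; congr (~~ _).
apply: depends_on_blocked => // v /(subsetP (branch_sub_reach _ _ _ _ DC)).
exact: tt'.
Qed.

Definition accept_prob j u C : R := mean (fun t => (accepted j u C t)%:R).

Definition block_prob j u D : R :=
  mean (fun t => (blocked (accepted j) j u D t)%:R).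

Lemma mean_unblocked j u C : (j < Q)%N ->
  mean (fun t =>
    [forall D, (Some D != C) ==> ~~ blocked (accepted j) j u D t]%:R) =
  \prod_(D | Some D != C) (1 - block_prob j u D).
Proof.
move=> jQ; pose free D t : R := 1 - (blocked (accepted j) j u D t)%:R.
transitivity (mean (fun t => \prod_(D | Some D != C) free D t)).
  apply: eq_mean => t; case: (boolP [forall D, _]) => [/forallP nb|].
    by rewrite big1 // => D DC; rewrite /free (negbTE (implyP (nb D) DC)) subr0.
  case/forallPn=> D; rewrite negb_imply negbK => /andP[DC bl].
  by rewrite (bigD1 D) //= /free bl subrr mul0r.
rewrite (mean_prod sum_unif (D := branch H c j u)).
- by apply: eq_bigr => D _; rewrite meanB mean_cst.
- move=> D _; apply: (depends_on_comp (fun b : bool => 1 - b%:R)).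
  exact/depends_on_blocked/depends_on_accepted.
- by move=> D1 D2 _ _; apply: (branch_disjoint H_acyclic); rewrite leq_double.
Qed.

Lemma accept_probS j u C : (j < Q)%N ->
  accept_prob j.+1 u C = accept_prob j u C + (uncapped (accepted j) u)%:R *
     (Q%:R^-1 * \prod_(D | Some D != C) (1 - block_prob j u D)).
Proof.
move=> jQ; pose B := \bigcup_D branch H c j u D.
rewrite -mean_unblocked //.
rewrite -[X in _%:R * (X * _)](mean_coord_eq sum_unif u (Ordinal jQ)).
rewrite -(mean_mul_disjoint sum_unif (A := [set u]) (B := B)).
- rewrite -meanZ -meanD; apply: eq_mean => t /=; rewrite -val_eqE /=.
  have [/acceptedP[tj _ _]|_] /= := boolP (accepted j u C t).
    by rewrite (ltn_eqF tj) /= mul0r mulr0 addr0.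
  by rewrite add0r -!natrM !mulnb andbCA.
- by move=> t t' tt'; rewrite tt' ?inE.
- move=> t t' tt'; congr (nat_of_bool _)%:R.
  apply: eq_forallb => D; congr (_ ==> ~~ _).
  apply: depends_on_blocked => [v C'|v vD]; first exact: depends_on_accepted.
  by apply: tt'; apply/bigcupP; exists D.
- rewrite disjoints1; apply/bigcupP => -[D _]; apply/negP.
  by apply: (root_notin_branch H_acyclic); lia.
Qed.

Section Round.
Variables (j : nat) (u : T).
Hypothesis jQ : (j < Q)%N.
Hypothesis prob_le : forall v C, accept_prob j v C <= 4 / Q%:R.
Local Notation z := (5 / Q%:R : R).
Local Notation occ v D := (fun t => (occupied (accepted j) j D v t)%:R : R).

Definition color_star D := [set e in H | (u \in e) && (c e == D)].

Let z_ge0 : 0 <= z. Proof. by rewrite divr_ge0 ?ler0n. Qed.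

Lemma mean_occupied_le v D : mean (occ v D) <= z.
Proof.
apply: (@le_trans _ _ (accept_prob j v (Some D) + Q%:R^-1)); last first.
  by have := prob_le v (Some D); lra.
rewrite -[X in _ + X](mean_coord_eq sum_unif v (Ordinal jQ)) -meanD.
apply: le_mean => // t; rewrite /occupied -val_eqE /=.
by case: accepted; case: eqP => _ /=; lra.
Qed.

Lemma mean_prod_occupied e : e \in H -> u \in e ->
  mean (fun t => \prod_(v in e :\ u) occ v (c e) t) <= z ^+ (k - 1).
Proof.
pose deps v := reach H c j v (Some (c e)).
move=> eH ue; rewrite (mean_prod sum_unif (D := deps)).
- rewrite -(card_edgeD1 eH ue) -prodr_const; apply: ler_prod => v _.
  by rewrite mean_occupied_le mean_ge0 // => t; exact: ler0n.
- move=> v _ t t' tt'; rewrite /occupied.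
  by rewrite (depends_on_accepted (t' := t')) ?(tt' v) ?mem_reach.
- move=> v w; rewrite !inE => /andP[_ ve] /andP[_ we] vw.
  by apply: (reach_disjoint H_acyclic) => //; lia.
Qed.

Lemma block_prob_le_color_star D :
  block_prob j u D <= #|color_star D|%:R * z ^+ (k - 1).
Proof.
have occ_ge0 e t : 0 <= \prod_(v in e :\ u) occ v D t.
  by apply: prodr_ge0 => v _; exact: ler0n.
apply: (@le_trans _ _ (mean (fun t =>
    \sum_(e in color_star D) \prod_(v in e :\ u) occ v D t))).
  apply: le_mean => // t.
  case: (boolP (blocked _ _ _ _ _)) => [|_]; last exact: sumr_ge0.
  case/exists_inP=> e eH /and3P[ue ce /forall_inP occ_e].
  rewrite (bigD1 e) /=; last by rewrite inE eH ue ce.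
  by rewrite big1 ?lerDl ?sumr_ge0 // => v /occ_e ->.
rewrite mean_sum mulr_natl -sumr_const; apply: ler_sum => e.
by rewrite inE => /and3P[eH ue /eqP <-]; exact: mean_prod_occupied.
Qed.

(* Fix two vertices other than [u] of one edge of colour [D]: every edge of that
   colour contains one of them, which is occupied when the edge blocks [u]. *)
Lemma block_prob_le_half D : block_prob j u D <= 2^-1.
Proof.
have double_z_le : z + z <= 2^-1.
  have : 20%:R <= Q%:R :> R by rewrite ler_nat.
  by rewrite -mulrDl ler_pdivrMr //; lra.
have [star_empty|/set0Pn[e]] := eqVneq (color_star D) set0.
  apply: le_trans (block_prob_le_color_star D) _.
  by rewrite star_empty cards0 mul0r invr_ge0.
rewrite inE => /and3P[eH ue /eqP ce].
have : (1 < #|e :\ u|)%N by rewrite (card_edgeD1 eH ue); lia.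
case/card_gt1P=> v [w []]; rewrite !inE => /andP[vu ve] /andP[wu we] vw.
apply: (@le_trans _ _ (mean (occ v D) + mean (occ w D))); last first.
  by apply: le_trans double_z_le; rewrite lerD ?mean_occupied_le.
rewrite -meanD; apply: le_mean => // t.
case: (boolP (blocked _ _ _ _ _)) => [|_]; last by rewrite addr_ge0 ?ler0n.
case/exists_inP=> f fH /and3P[uf /eqP cf /forall_inP occ_f].
have : (v \in f) || (w \in f).
  apply: (@mem_of_card_setI_pred _ e) vw => //.
  rewrite (uniformP _ _ H_unif e eH) -add1n -leq_subLR.
  exact: meet_class eH fH (etrans ce (esym cf)).
by case/orP=> [vf|wf]; [rewrite (occ_f v) ?lerDl | rewrite (occ_f w) ?lerDr];
  rewrite ?ler0n // !inE ?vu ?wu.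
Qed.

Lemma sum_card_color_star : (\sum_D #|color_star D| = degree H u)%N.
Proof.
rewrite /degree /codegree -sum1dep_card (partition_big c xpredT) //=.
apply: eq_bigr => D _; rewrite -sum1dep_card; apply: eq_bigl => e.
by rewrite sub1set andbA.
Qed.

Lemma prod_unblocked_ge (d : R) : (degree H u)%:R <= d ->
  expR (- (2 * d * z ^+ (k - 1))) <= \prod_D (1 - block_prob j u D).
Proof.
rewrite -sum_card_color_star => deg_le; have zk_ge0 := exprn_ge0 (k - 1) z_ge0.
apply: (@le_trans _ _
    (expR (\sum_D - (2 * (#|color_star D|%:R * z ^+ (k - 1)))))).
  rewrite ler_expR sumrN lerN2 -mulr_sumr -mulr_suml mulrA -natr_sum.
  by rewrite ler_wpM2r // ler_wpM2l.
rewrite expR_sum; apply: ler_prod => D _; rewrite expR_ge0 /=.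
apply: expR_le_1Bx; rewrite ?mulr_ge0 ?block_prob_le_color_star //.
exact: block_prob_le_half.
Qed.

Lemma accept_probS_le_double C :
  accept_prob j u C <= 2 * accept_prob j u None ->
  accept_prob j.+1 u C <= 2 * accept_prob j.+1 u None.
Proof.
move=> IH; rewrite !accept_probS // mulrDr lerD // [leRHS]mulrCA ler_wpM2l //.
rewrite [leRHS]mulrCA ler_wpM2l ?invr_ge0 //.
have free_ge D : 2^-1 <= 1 - block_prob j u D.
  by have := block_prob_le_half D; lra.
have free_ge0 D : 0 <= 1 - block_prob j u D by apply: le_trans (free_ge D); lra.
case: C {IH} => [D0|]; last by rewrite ler_peMl ?ler1n ?prodr_ge0.
rewrite [X in _ <= _ * X](bigD1 D0) //= mulrA ler_peMl ?prodr_ge0 //.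
by have := free_ge D0; lra.
Qed.

End Round.

Lemma accept_prob_cap j u : (j <= Q)%N ->
  accept_prob j u None <= 2 / Q%:R /\
  forall C, accept_prob j u C <= 2 * accept_prob j u None.
Proof.
elim: j u => [|j IH] u jQ.
  have prob0 C : accept_prob 0 u C = 0 by rewrite -[RHS](mean_cst T sum_unif 0).
  by rewrite prob0; split=> [|C]; rewrite ?prob0 ?mulr0 // divr_ge0 ?ler0n.
have {}IH v := IH v (ltnW jQ).
have prob_le v C : accept_prob j v C <= 4 / Q%:R.
  by have [none_le /(_ C) le_none] := IH v; lra.
split=> [|C]; last by apply: accept_probS_le_double => //; case: (IH u).
rewrite accept_probS //; case: (boolP (uncapped _ _)) => [cap|_]; last first.
  by rewrite mul0r addr0; case: (IH u).
have -> : 2 / Q%:R = Q%:R^-1 + Q%:R^-1 :> R by ring.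
rewrite mul1r lerD // ler_piMr ?invr_ge0 //; apply: prodr_ile1 => D _.
rewrite subr_ge0 (le_trans (block_prob_le_half _ jQ prob_le _)) /=; last lra.
by rewrite gerBl; apply: mean_ge0 => // t; rewrite ler0n.
Qed.

Lemma accept_prob_le j v C : (j <= Q)%N -> accept_prob j v C <= 4 / Q%:R.
Proof. by move=> /(accept_prob_cap v)[none_le /(_ C) le_none]; lra. Qed.

Lemma accept_prob_final (d : R) u : (degree H u)%:R <= d ->
  2 < Q%:R * expR (- (2 * d * (5 / Q%:R) ^+ (k - 1))) ->
  Q%:R^-1 <= accept_prob Q u None.
Proof.
set q := expR _ => deg_le two_lt.
have prod_ge j : (j < Q)%N ->
    q <= \prod_(D | Some D != None) (1 - block_prob j u D).
  move=> jQ; apply: prod_unblocked_ge => // v C.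
  exact: accept_prob_le (ltnW jQ).
suff growth j : (j <= Q)%N ->
    Q%:R^-1 <= accept_prob j u None \/
    j%:R * (Q%:R^-1 * q) <= accept_prob j u None.
  case: (growth Q (leqnn Q)) => // q_le; exfalso.
  have [] := accept_prob_cap u (leqnn Q); rewrite leNgt => /negP + _; apply.
  apply: lt_le_trans q_le; rewrite mulrA mulfV ?gt_eqF // mul1r.
  by rewrite ltr_pdivrMr // mulrC.
elim: j => [|j IH] jQ.
  by right; rewrite mul0r mean_ge0 // => t; rewrite ler0n.
have Qq_le : Q%:R^-1 * q <=
    Q%:R^-1 * \prod_(D | Some D != None) (1 - block_prob j u D).
  by rewrite ler_wpM2l ?invr_ge0 ?ler0n ?prod_ge.
have Qq_ge0 : 0 <= Q%:R^-1 * q by rewrite mulr_ge0 ?invr_ge0 ?ler0n ?expR_ge0.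
rewrite accept_probS //; case: (IH (ltnW jQ)) => prob_ge.
  by left; rewrite (le_trans prob_ge) // lerDl mulr_ge0 // (le_trans Qq_ge0).
case: (boolP (uncapped (accepted j) u)) => [_|].
  by right; rewrite mul1r -natr1 mulrDl mul1r lerD.
by rewrite -ltNge mul0r addr0 => /ltW capped; left.
Qed.

Lemma greedy_independent (d : R) (A : {set T}) :
  {in A, forall u, (degree H u)%:R <= d} ->
  2 < Q%:R * expR (- (2 * d * (5 / Q%:R) ^+ (k - 1))) ->
  exists S : {set T}, [/\ S \subset A, independent H S & (#|A| <= Q * #|S|)%N].
Proof.
move=> deg_le two_lt; pose S t := [set u in A | accepted Q u None t].
have [t card_ge] := exists_ge_mean unif_ge0 sum_unif (fun t => #|S t|%:R).
exists (S t); split.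
- by apply/subsetP => u; rewrite inE => /andP[].
- apply: contra (accepted_independent Q t) => /exists_inP[e eH eS].
  apply/exists_inP; exists e => //; apply: subset_trans eS _.
  by apply/subsetP => u; rewrite !inE => /andP[].
rewrite -(ler_nat R) natrM -ler_pdivrMl //; apply: le_trans card_ge.
under eq_mean do rewrite natr_card_sep.
rewrite mean_sum mulr_natr -sumr_const; apply: ler_sum => u uA.
exact: accept_prob_final (deg_le u uA) two_lt.
Qed.

End Greedy.

(** * Acyclicity from the absence of small dense unions *)

Section Growth.
Variables (T : finType) (H : {set {set T}}) (k : nat).
Local Open Scope nat_scope.

Definition glue (P : pred nat) (F : {set {set T}}) : {set {set T}} :=
  [set W :|: e | W in F, e in H & P #|e :&: W|].

Definition sparse_meet : pred nat := [pred i | (i == 1) || (i == k - 1)].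

Definition dense_meet : pred nat := [pred i | 2 <= i <= k - 2].

Definition sparse_unions j := iter j (glue sparse_meet) H.

Definition dense_unions j := glue dense_meet (sparse_unions j).

Lemma card_sparse_union j W :
  uniform k H -> W \in sparse_unions j -> #|W| <= k * j.+1.
Proof.
move=> /uniformP Hk; elim: j W => [|j IH] W /=.
  by move=> /Hk ->; rewrite muln1.
case/imset2P=> V e /IH Vj; rewrite inE => /andP[/Hk ek _] ->.
rewrite mulnS addnC; apply: leq_trans (leq_of_leqif (leq_card_setU _ _)) _.
by rewrite ek leq_add2r.
Qed.

End Growth.

Section DenseFree.
Variables (T K : finType) (H : {set {set T}}) (c : {set T} -> K).
Variables (k M : nat) (A : {set T}).
Local Open Scope nat_scope.
Hypothesis k_ge4 : 4 <= k.
Hypothesis H_unif : uniform k H.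
Hypothesis meet_other_color :
  {in H &, forall e f : {set T}, c e != c f -> #|e :&: f| <= k - 3}.
Hypothesis meet_same_color :
  {in H &, forall e f : {set T}, c e = c f -> e :&: f != set0}.
Hypothesis A_dense_free :
  forall j W, j < M -> W \in dense_unions H k j -> ~~ (W \subset A).
Implicit Types (e : {set T}) (s b : seq {set T}).
Implicit Types (es : nat -> {set T}) (vs : nat -> T).

Let HA := H ::&: A.

Definition union_seq s := \bigcup_(e <- s) e.

Fixpoint linked s : bool :=
  if s is e :: s' then (s' == [::]) || (e :&: union_seq s' != set0) && linked s'
  else true.

Lemma union_seq_cons e s : union_seq (e :: s) = e :|: union_seq s.
Proof. by rewrite /union_seq big_cons. Qed.

Lemma union_seq_catr s b : union_seq b \subset union_seq (s ++ b).
Proof. by rewrite /union_seq big_cat subsetUr. Qed.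

Lemma union_seq_subset s : {subset s <= HA} -> union_seq s \subset A.
Proof.
move=> sHA; rewrite /union_seq big_seq.
by elim/big_ind: _ => [|e f eA fA|e /sHA];
  rewrite ?sub0set ?subUset ?eA // inE => /andP[].
Qed.

Lemma dense_meet_excluded j W e : j < M -> W \in sparse_unions H k j ->
  W \subset A -> e \in HA -> ~~ dense_meet k #|e :&: W|.
Proof.
move=> jM Wj WA; rewrite inE => /andP[eH eA]; apply/negP => dense.
have /(A_dense_free jM) : W :|: e \in dense_unions H k j.
  by apply/imset2P; exists W e => //; rewrite inE eH.
by rewrite subUset WA eA.
Qed.

Lemma linked_sparse_union s : {subset s <= HA} -> linked s -> 0 < size s <= M ->
  exists2 j, j < size s & union_seq s \in sparse_unions H k j.
Proof.
elim: s => // e s IH sHA /= linked_s sM.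
have eHA := sHA e (mem_head _ _).
have eH : e \in H by move: eHA; rewrite inE => /andP[].
have {}sHA : {subset s <= HA} by move=> f fs; apply: sHA; rewrite inE fs orbT.
case: (posnP (size s)) => [/size0nil s0|s_gt0].
  by exists 0; rewrite // s0 /union_seq big_seq1.
have {linked_s} : (e :&: union_seq s != set0) && linked s.
  by case: s s_gt0 linked_s {IH sM sHA}.
rewrite -card_gt0 => /andP[meet_gt0 linked_s].
have [|j js Wj] := IH sHA linked_s; first by rewrite s_gt0 ltnW.
have jM : j < M by apply: leq_trans js (ltnW sM).
have not_dense := dense_meet_excluded jM Wj (union_seq_subset sHA) eHA.
have card_e := uniformP _ _ H_unif e eH.
have [sub|nsub] := boolP (e \subset union_seq s).
  by exists j; [exact: ltnW | rewrite union_seq_cons (setUidPr sub)].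
have meet_lt : #|e :&: union_seq s| < k.
  rewrite -card_e proper_card // properE subsetIl.
  by apply: contra nsub => /subset_trans; apply; exact: subsetIr.
exists j.+1 => //; rewrite union_seq_cons /sparse_unions iterS setUC.
apply/imset2P; exists (union_seq s) e => //; rewrite inE eH /=.
move: meet_gt0 meet_lt not_dense; rewrite /sparse_meet /dense_meet /=.
by clear; lia.
Qed.

(* The first time that the growing union meets [e] twice, it meets it in at most
   [1 + (k - 3)] vertices. *)
Lemma meet_union_le1 s e : {subset s <= HA} -> linked s -> size s <= M ->
  e \in HA -> {in s, forall f, c f != c e} -> #|e :&: union_seq s| <= 1.
Proof.
elim: s => [|f s IH] sHA linked_s sM eHA se.
  by rewrite /union_seq big_nil setI0 cards0.
have /andP[fH _] : (f \in H) && (f \subset A).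
  by have := sHA f (mem_head _ _); rewrite inE.
have /andP[eH _] : (e \in H) && (e \subset A) by rewrite inE in eHA.
have [j js Wj] := linked_sparse_union sHA linked_s sM.
have := dense_meet_excluded (leq_trans js sM) Wj (union_seq_subset sHA) eHA.
have meet_s : #|e :&: union_seq s| <= 1.
  apply: IH => //.
  - by move=> x xs; apply: sHA; rewrite inE xs orbT.
  - by move: linked_s => /= /orP[/eqP ->|/andP[]].
  - exact: ltnW.
  - by move=> x xs; apply: se; rewrite inE xs orbT.
have meet_f : #|e :&: f| <= k - 3.
  by apply: meet_other_color; rewrite // eq_sym se ?mem_head.
have : #|e :&: union_seq (f :: s)| <= #|e :&: f| + #|e :&: union_seq s|.
  by rewrite union_seq_cons setIUr cardsU leq_subr.
by move: meet_s meet_f; rewrite /dense_meet /=; move: k_ge4; clear; lia.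
Qed.

Definition segment es i m := rev [seq es l | l <- iota i m].

Lemma segmentS es i m : segment es i m.+1 = es (i + m) :: segment es i m.
Proof. by rewrite /segment -addn1 iotaD map_cat rev_cat. Qed.

Lemma mem_segment es i m e :
  reflect (exists2 l, i <= l < i + m & e = es l) (e \in segment es i m).
Proof.
rewrite mem_rev; apply: (iffP mapP) => -[l il ->]; exists l => //; move: il;
by rewrite mem_iota.
Qed.

Lemma linked_segment L es vs i m b :
  proper_walk HA c L es vs -> i + m <= L -> linked b -> vs i \in union_seq b ->
  linked (segment es i m ++ b) /\
  vs (i + m) \in union_seq (segment es i m ++ b).
Proof.
move=> [walk _] + linked_b vb; elim: m => [|m IH] iL; first by rewrite addn0.
have [|linked_m vm] := IH; first by lia.
have /walk[_ v1 v2 _] : i + m < L by lia.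
rewrite segmentS /= union_seq_cons addnS inE v2 linked_m andbT; split=> //.
by apply/orP; right; apply/set0Pn; exists (vs (i + m)); rewrite inE v1.
Qed.

Lemma walk_avoids_base L es vs i j b : proper_walk HA c L es vs -> i < j < L ->
  {subset b <= HA} -> linked b -> vs i.+1 \in union_seq b ->
  size b + (j - i.+1) <= M -> {in b, forall f, c f != c (es j)} ->
  (forall l, i < l < j -> c (es l) != c (es j)) -> vs j.+1 \notin union_seq b.
Proof.
move=> walk /andP[ij jL] bHA linked_b vb size_b color_b color_l.
have [|linked_s] := linked_segment walk (m := j - i.+1) _ linked_b vb.
  by rewrite subnKC // ltnW.
rewrite subnKC // => vj_s; set s := segment _ _ _ ++ b in linked_s vj_s.
have esHA l : l < L -> es l \in HA by case: walk => [w _] /w[].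
have in_s f : f \in s -> f \in b \/ exists2 l, i < l < j & f = es l.
  rewrite mem_cat orbC => /orP[|/mem_segment[l]]; first by left.
  by rewrite subnKC // => ijl ->; right; exists l.
have [vsj vsjS vs_ne] : [/\ vs j \in es j, vs j.+1 \in es j & vs j != vs j.+1].
  by case: walk => [w _]; have [] := w j jL.
apply: contraL (_ : #|es j :&: union_seq s| <= 1) => [vb'|].
  rewrite -ltnNge; apply/card_gt1P; exists (vs j), (vs j.+1).
  by rewrite !inE vsj vsjS vj_s (subsetP (union_seq_catr _ _)).
apply: meet_union_le1 => //.
- by move=> f /in_s[/bHA //|[l ijl ->]]; apply: esHA; lia.
- by rewrite size_cat size_rev size_map size_iota addnC.
- exact: esHA.
- by move=> f /in_s[/color_b //|[l ijl ->]]; exact: color_l.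
Qed.

Lemma walk_colors_neq L es vs i j : proper_walk HA c L es vs -> L <= M ->
  i < j < L -> c (es i) != c (es j).
Proof.
move=> walk LM; have [m] := ubnP (j - i).
elim: m i j => // m IH i j jim /andP[ij jL]; case: (walk) => w color_next.
have [j_eq|j_ne] := eqVneq j i.+1; first by rewrite j_eq color_next -?j_eq.
apply/negP => /eqP cij.
have esH l : l < L -> es l \in HA /\ es l \in H.
  by move=> /w[esl _ _ _]; split=> //; move: esl; rewrite inE => /andP[].
have [iL j1L] : i < L /\ j.-1 < L by lia.
have [[esjA esjH] [esiA esiH]] := (esH j jL, esH i iL).
have jE : j.-1.+1 = j by lia.
suff : vs j.-1.+1 \notin union_seq [:: es j; es i].
  by have [_ vsj _ _] := w j jL; rewrite jE union_seq_cons inE vsj.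
apply: (walk_avoids_base walk (i := i)); first lia.
- by move=> f; rewrite in_cons mem_seq1 => /orP[]/eqP ->.
- by rewrite /= /union_seq big_seq1 andbT meet_same_color.
- by have [_ _ vsi _] := w i iL; rewrite !union_seq_cons !inE vsi orbT.
- by rewrite /=; lia.
- move=> f; rewrite !inE => /orP[]/eqP ->; last by apply: IH; lia.
  by rewrite eq_sym -[X in _ != c (es X)]jE color_next ?jE.
- by move=> l il; apply: IH; lia.
Qed.

Lemma dense_free_acyclic : acyclic_upto HA c M.
Proof.
move=> L es vs LM walk; case: (walk) => w _; apply/eqP => v0L.
have [L1|L2] : L = 1 \/ 2 <= L by lia.
  by have /w[_ _ _] : 0 < L; [lia | rewrite v0L L1 eqxx].
have [|es0 vs0 vs1 _] := w 0; first lia.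
suff : vs L.-1.+1 \notin union_seq [:: es 0].
  by rewrite prednK -?v0L /union_seq ?big_seq1 ?vs0 //; lia.
apply: (walk_avoids_base walk (i := 0)); rewrite ?/union_seq ?big_seq1 //=.
- by move: L2; clear; lia.
- by move=> f; rewrite mem_seq1 => /eqP ->.
- by move: LM; clear; lia.
- by move=> f; rewrite mem_seq1 => /eqP ->; apply: (walk_colors_neq walk); lia.
- by move=> l l_lt; apply: (walk_colors_neq walk); lia.
Qed.

End DenseFree.

(** * First-moment deletion *)

Lemma exists_deletion (R : realFieldType) (T : finType) (k : nat)
    (H F : {set {set T}}) (d : R) (J : {set T}) :
  0 < d -> uniform k H -> set0 \notin F ->
  exists A : {set T}, [/\ {in F, forall W : {set T}, ~~ (W \subset A)},
    {in A, forall v, (degree (H ::&: A) v)%:R <= d} &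
    #|J|%:R - #|F ::&: J|%:R - k%:R / d * #|H ::&: J|%:R <= #|A|%:R].
Proof.
move=> d0 H_unif F0.
have [|B B_le hitB] := @exists_hitting_set _ (F ::&: J).
  by rewrite inE (negbTE F0).
pose D := [set v | d < (degree (H ::&: J) v)%:R]; pose A := J :\: B :\: D.
have AJ : A \subset J := subset_trans (subsetDl _ _) (subsetDl _ _).
exists A; split.
- move=> W WF; apply/negP => WA.
  have /hitB/set0Pn[x] : W \in F ::&: J by rewrite inE WF (subset_trans WA).
  by rewrite inE => /andP[/(subsetP WA)]; rewrite !inE => /and3P[_ /negP].
- move=> v; rewrite !inE => /and3P[vD _ _]; rewrite leNgt; apply: contra vD.
  move/lt_le_trans; apply; rewrite ler_nat codegreeS //; apply/subsetP => e.
  by rewrite !inE => /andP[-> eA]; exact: subset_trans eA AJ.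
have D_le : #|D|%:R <= k%:R / d * #|H ::&: J|%:R.
  rewrite mulrAC ler_pdivlMr // -natrM; apply: card_large_degree.
  by apply: uniformS H_unif; apply/subsetP => e; rewrite inE => /andP[].
have J_le : (#|J| <= #|A| + #|B| + #|D|)%N.
  rewrite -(cardsID B J) -(cardsID D (J :\: B)) -/A.
  have := subset_leq_card (subsetIr J B).
  by have := subset_leq_card (subsetIr (J :\: B) D); lia.
move: J_le B_le; rewrite -!(ler_nat R) !natrD => J_le B_le.
by lra.
Qed.

Section Sampling.
Variables (R : realFieldType) (T : finType) (p : R).
Hypothesis p_ge0 : 0 <= p.
Hypothesis p_le1 : p <= 1.
Implicit Types (W : {set T}) (F : {set {set T}}) (t : {ffun T -> bool}).

Definition weight F : R := \sum_(W in F) p ^+ #|W|.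

Lemma weight_uniform k H : uniform k H -> weight H = #|H|%:R * p ^+ k.
Proof.
move=> /uniformP Hk; rewrite mulr_natl -sumr_const.
by apply: eq_bigr => e /Hk ->.
Qed.

Local Notation bernoulli := (fun b : bool => if b then p else 1 - p).
Local Notation mean := (mean bernoulli).

Let sample t : {set T} := [set v | t v].
Let bernoulli_ge0 b : 0 <= bernoulli b.
Proof. by case: b; rewrite ?subr_ge0. Qed.
Let sum_bernoulli : \sum_b bernoulli b = 1.
Proof. by rewrite big_bool /= addrC subrK. Qed.

Lemma mean_subset_sample W :
  mean (fun t => (W \subset sample t)%:R) = p ^+ #|W|.
Proof.
transitivity (mean (fun t => [forall v in W, id (t v)]%:R)).
  apply: eq_mean => t; congr (nat_of_bool _)%:R.
  by apply/subsetP/forall_inP => Wt v /Wt; rewrite inE.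
by rewrite (mean_forall sum_bernoulli W id) big_mkcond big_bool /= addr0.
Qed.

Lemma mean_card_induced F : mean (fun t => #|F ::&: sample t|%:R) = weight F.
Proof.
under eq_mean do rewrite natr_card_sep.
by rewrite mean_sum; apply: eq_bigr => W _; exact: mean_subset_sample.
Qed.

Lemma mean_card_sample : mean (fun t => #|sample t|%:R) = p * #|T|%:R.
Proof.
transitivity (\sum_v mean (fun t => (t v == true)%:R)).
  rewrite -mean_sum; apply: eq_mean => t.
  rewrite -sum1dep_card natr_sum big_mkcond.
  by apply: eq_bigr => v _; rewrite eqb_id; case: (t v).
under eq_bigr do rewrite (mean_coord_eq sum_bernoulli).
by rewrite sumr_const mulr_natr.
Qed.

Lemma exists_sparse_sample k H F (d : R) :
  0 < d -> uniform k H -> set0 \notin F ->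
  exists A : {set T}, [/\ {in F, forall W : {set T}, ~~ (W \subset A)},
    {in A, forall v, (degree (H ::&: A) v)%:R <= d} &
    p * #|T|%:R - weight F - k%:R / d * weight H <= #|A|%:R].
Proof.
move=> d0 H_unif F0.
have [t] := exists_ge_mean bernoulli_ge0 sum_bernoulli (fun t =>
  #|sample t|%:R - #|F ::&: sample t|%:R - k%:R / d * #|H ::&: sample t|%:R).
rewrite !meanB meanZ mean_card_sample !mean_card_induced => ge_mean.
have [A [AF A_deg A_card]] := exists_deletion (sample t) d0 H_unif F0.
by exists A; split=> //; exact: le_trans ge_mean A_card.
Qed.

End Sampling.

(** * Hypergraphs omitting the intersection size [k - 2] *)

Lemma card_supersets_le (T : finType) (A : {set T}) i :
  (#|[set S : {set T} | A \subset S & #|S| == i]| <= #|T| ^ (i - #|A|))%N.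
Proof.
apply: leq_trans (leq_bin_exp _ _); rewrite -card_draws.
rewrite -(card_in_imset (f := fun S => S :\: A)).
  apply/subset_leq_card/subsetP => _ /imsetP[S + ->].
  by rewrite !inE => /andP[AS /eqP <-]; rewrite cardsD (setIidPr AS).
move=> S S'; rewrite !inE => /andP[AS _] /andP[AS' _] eqD.
by rewrite -(setID S A) -(setID S' A) eqD (setIidPr AS) (setIidPr AS').
Qed.

Lemma omitting_systemP (T : finType) n k l (H : {set {set T}}) :
  omitting_system n k l H -> [/\ #|T| = n, uniform k H &
    {in H &, forall e f : {set T}, e != f -> (#|e :&: f| != l)%N}].
Proof.
case/and3P=> /eqP cardT H_unif /forall_inP H_omit; split=> // e f eH fH ef.
by have /forall_inP/(_ f fH)/implyP := H_omit e eH; apply.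
Qed.

Section Omitting.
Variables (T : finType) (H : {set {set T}}) (k : nat).
Local Open Scope nat_scope.
Hypothesis k_ge3 : 3 <= k.
Hypothesis H_unif : uniform k H.
Hypothesis H_omit :
  {in H &, forall e f : {set T}, e != f -> #|e :&: f| != k - 2}.
Implicit Types (e f h A S : {set T}).

Let card_edge e : e \in H -> #|e| = k.
Proof. exact: (uniformP _ _ H_unif). Qed.

Lemma omitting_meet : {in H &, forall e f,
  k - 2 <= #|e :&: f| -> k - 1 <= #|e :&: f|}.
Proof.
move=> e f eH fH ef; have [<-|ne] := eqVneq e f.
  by rewrite setIid card_edge //; lia.
by have := H_omit eH fH ne; lia.
Qed.

Lemma omitting_meet_trans : {in H & &, forall e f h,
  k - 2 <= #|e :&: f| -> k - 2 <= #|f :&: h| -> k - 2 <= #|e :&: h|}.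
Proof.
move=> e f h eH fH hH /(omitting_meet eH fH) ef /(omitting_meet fH hH) fh.
have card_union : #|(e :&: f) :|: (f :&: h)| <= k.
  by rewrite -(card_edge fH) subset_leq_card // subUset subsetIr subsetIl.
have card_inter : #|(e :&: f) :&: (f :&: h)| <= #|e :&: h|.
  exact/subset_leq_card/setISS/subsetIr/subsetIl.
by have := cardsUI (e :&: f) (f :&: h); lia.
Qed.

Definition eclass e := [set f in H | k - 2 <= #|e :&: f|].

Lemma mem_eclass e : e \in H -> e \in eclass e.
Proof. by move=> eH; rewrite inE eH setIid card_edge // leq_subr. Qed.

Lemma eclass_meet : {in H &, forall e f,
  eclass e = eclass f -> k - 1 <= #|e :&: f|}.
Proof.
move=> e f eH fH ef; apply: omitting_meet => //.
by have := mem_eclass fH; rewrite -ef inE => /andP[].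
Qed.

Lemma eclass_eq : {in H &, forall e f,
  k - 2 <= #|e :&: f| -> eclass e = eclass f}.
Proof.
move=> e f eH fH ef; apply/setP => h; rewrite !inE; case hH: (h \in H) => //=.
by apply/idP/idP; apply: omitting_meet_trans; rewrite // setIC.
Qed.

Lemma eclass_neq_meet : {in H &, forall e f,
  eclass e != eclass f -> #|e :&: f| <= k - 3}.
Proof.
move=> e f eH fH; apply: contraNleq => ef; apply/eqP/eclass_eq => //.
by move: ef k_ge3; clear; lia.
Qed.

Definition class_rep e := odflt e [pick f in eclass e].

Lemma class_repP e :
  e \in H -> class_rep e \in H /\ k - 1 <= #|e :&: class_rep e|.
Proof.
move=> eH; rewrite /class_rep.
case: pickP => [f|/(_ e)]; last by rewrite mem_eclass.
by rewrite inE => /andP[fH ef]; split=> //; apply: omitting_meet.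
Qed.

Lemma class_rep_eq : {in H &, forall e f,
  k - 2 <= #|e :&: f| -> class_rep e = class_rep f}.
Proof.
move=> e f eH fH /(eclass_eq eH fH) ef; rewrite /class_rep ef.
by case: pickP => // /(_ f); rewrite mem_eclass.
Qed.

Definition anchored S e :=
  [&& S \subset e, #|S| == k - 2 & e :\: class_rep e \subset S].

Lemma exists_anchored A e : e \in H -> A \subset e -> #|A| <= k - 3 ->
  exists2 S : {set T}, A \subset S & anchored S e.
Proof.
move=> eH Ae cardA; have [_ e_rep] := class_repP eH.
have D_le1 : #|e :\: class_rep e| <= 1 by rewrite cardsD (card_edge eH); lia.
pose B := A :|: (e :\: class_rep e).
have [||S [AS Se cardS]] := @exists_subset_card _ B e (k - 2).
- by rewrite subUset Ae subsetDl.
- have := leq_of_leqif (leq_card_setU A (e :\: class_rep e)).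
  by rewrite -/B (card_edge eH); lia.
move: AS; rewrite subUset => /andP[AS DS].
by exists S; rewrite // /anchored Se cardS eqxx.
Qed.

(* Edges anchored at [S] share [S], hence a class and its representative [e0];
   such an edge [e] is determined by [e :&: e0], which misses at most one vertex
   of [e0], since [e :\: e0 = S :\: e0]. *)
Lemma card_anchored_le S : #|[set e in H | anchored S e]| <= k.+1.
Proof.
have [->|/set0Pn[e1]] := eqVneq [set e in H | anchored S e] set0.
  by rewrite cards0.
rewrite inE => /andP[e1H /and3P[Se1 /eqP cardS _]].
set e0 := class_rep e1; have [e0H _] := class_repP e1H.
have anchoredE e : e \in [set e in H | anchored S e] ->
    [/\ e \in H, k - 1 <= #|e :&: e0| & e :\: e0 = S :\: e0].
  rewrite inE => /andP[eH /and3P[Se _ DS]].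
  have rep_e : class_rep e = e0.
    by apply: class_rep_eq; rewrite // -cardS subset_leq_card // subsetI Se.
  have [_ e_rep] := class_repP eH; rewrite rep_e in e_rep DS; split=> //.
  apply/eqP; rewrite eqEsubset (setSD _ Se) andbT; apply/subsetP => x xD.
  by rewrite inE (subsetP DS) // andbT; move: xD; rewrite inE => /andP[].
rewrite -(card_in_imset (f := fun e => e :&: e0)); last first.
  move=> e f /anchoredE[_ _ eS] /anchoredE[_ _ fS] ef.
  by rewrite -(setID e e0) -(setID f e0) ef eS fS.
apply: (@leq_trans #|e0 |: [set e0 :\ x | x in e0]|).
  apply/subset_leq_card/subsetP => _ /imsetP[e /anchoredE[eH e_e0 _] ->].
  have [||->|[x xe0 ->]] := @subset_card_pred _ (e :&: e0) e0.
  - exact: subsetIr.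
  - by rewrite (card_edge e0H); lia.
  - exact: setU11.
  - exact/setU1r/imset_f.
rewrite cardsU1 -add1n leq_add ?leq_b1 //.
by rewrite (leq_trans (leq_imset_card _ _)) // card_edge.
Qed.

Lemma codegree_le A : #|A| <= k - 3 ->
  codegree H A <= k.+1 * #|T| ^ (k - 2 - #|A|).
Proof.
move=> cardA; pose SS := [set S : {set T} | A \subset S & #|S| == k - 2].
pose fiber S := [set e in H | anchored S e].
apply: (@leq_trans #|cover (fiber @: SS)|).
  apply/subset_leq_card/subsetP => e; rewrite inE => /andP[eH Ae].
  have [S AS Se] := exists_anchored eH Ae cardA.
  rewrite cover_imset; apply/bigcupP; exists S; rewrite inE ?eH //.
  by rewrite AS; case/and3P: Se.
apply: leq_trans (leq_of_leqif (leq_card_cover _)) _.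
apply: (@leq_trans (\sum_(X in fiber @: SS) k.+1)).
  by apply: leq_sum => _ /imsetP[S _ ->]; exact: card_anchored_le.
rewrite sum_nat_const mulnC leq_mul2l /= (leq_trans (leq_imset_card _ _)) //.
exact: card_supersets_le.
Qed.

Lemma codegree_le_double (R : numDomainType) (x : R) A : (0 <= x)%R ->
  (forall S, #|S| = k - 1 -> ((codegree H S)%:R <= x)%R) -> #|A| = k - 2 ->
  ((codegree H A)%:R <= 2 * x)%R.
Proof.
move=> x0 codeg_le cardA; rewrite mulr_natl mulr2n.
have [star_empty|/set0Pn[e]] := eqVneq [set e in H | A \subset e] set0.
  by rewrite /codegree star_empty cards0 addr_ge0.
rewrite inE => /andP[eH Ae].
have /cards2P[y [z [yz eA]]] : #|e :\: A| == 2.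
  by rewrite cardsD (setIidPr Ae) card_edge // cardA; move: k_ge3; clear; lia.
have [ye yA] : y \in e /\ y \notin A.
  by apply/andP; rewrite andbC -in_setD eA set21.
have [ze zA] : z \in e /\ z \notin A.
  by apply/andP; rewrite andbC -in_setD eA set22.
have codeg_le1 v : v \notin A -> ((codegree H (v |: A))%:R <= x)%R.
  move=> vA; apply: codeg_le; rewrite cardsU1 vA cardA.
  by move: k_ge3; clear; lia.
apply: le_trans (lerD (codeg_le1 y yA) (codeg_le1 z zA)).
rewrite -natrD ler_nat; apply: leq_trans (leq_of_leqif (leq_card_setU _ _)).
apply/subset_leq_card/subsetP => f; rewrite !inE => /andP[fH Af].
rewrite fH !subUset !sub1set Af !andbT.
apply: (@mem_of_card_setI_pred _ e) => //.
rewrite (card_edge eH) -add1n -leq_subLR; apply: omitting_meet => //.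
by rewrite -cardA subset_leq_card // subsetI Ae.
Qed.

End Omitting.

(** * Weights of the unions of edges *)

Section GlueWeight.
Variables (R : realFieldType) (T : finType) (H : {set {set T}}) (k : nat).
Variable p : R.
Hypothesis p_ge0 : 0 <= p.
Hypothesis H_unif : uniform k H.
Implicit Types (W S : {set T}).

Lemma weight_glue (P : pred nat) (F : {set {set T}}) (B : R) :
  (forall W, W \in F -> \sum_(e in H | P #|e :&: W|) p ^+ #|e :\: W| <= B) ->
  weight p (glue H P F) <= B * weight p F.
Proof.
move=> sum_le; have pX_ge0 (W : {set T}) : 0 <= p ^+ #|W| by exact: exprn_ge0.
have -> : glue H P F =
    \bigcup_(W in F) [set W :|: e | e in [set e in H | P #|e :&: W|]].
  apply/setP => X; apply/imset2P/bigcupP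
    => [[W e WF eP ->]|[W WF /imsetP[e eP ->]]].
    by exists W; rewrite // imset_f.
  by exists W e.
apply: le_trans (ler_sum_bigcup _ _ pX_ge0) _; rewrite mulr_sumr.
apply: ler_sum => W WF; apply: le_trans (ler_sum_imset _ _ pX_ge0) _.
rewrite mulrC; apply: le_trans (ler_wpM2l (pX_ge0 W) (sum_le W WF)).
rewrite mulr_sumr; under eq_bigl do rewrite inE.
apply: ler_sum => e _.
by rewrite -exprD -(cardsID W (W :|: e)) setUK setDUl setDv set0U.
Qed.

Lemma sum_meet_card_le W i (x : R) : 0 <= x ->
  (forall S, #|S| = i -> (codegree H S)%:R <= x) ->
  \sum_(e in H | #|e :&: W| == i) p ^+ #|e :\: W| <=
    #|W|%:R ^+ i * (x * p ^+ (k - i)).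
Proof.
move=> x0 codeg_le; have pk0 : 0 <= p ^+ (k - i) by rewrite exprn_ge0.
pose subs := [set S : {set T} | S \subset W & #|S| == i].
rewrite (partition_big (fun e => e :&: W) (mem subs)) /=; last first.
  by move=> e /andP[_ ei]; rewrite inE subsetIr.
apply: (@le_trans _ _ (\sum_(S in subs) x * p ^+ (k - i))); last first.
  rewrite sumr_const -[_ *+ _]mulr_natl cards_draws -natrX.
  by rewrite ler_wpM2r ?mulr_ge0 // ler_nat leq_bin_exp.
apply: ler_sum => S; rewrite inE => /andP[SW /eqP cardS].
apply: (@le_trans _ _ (\sum_(e in [set e in H | S \subset e]) p ^+ (k - i))).
  rewrite big_mkcond [leRHS]big_mkcond; apply: ler_sum => e _; rewrite inE.
  case: (boolP (e \in H)) => //= eH; case: eqP => [ei|_]; last by case: ifP.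
  case: eqP => [<-|_] /=; last by case: ifP.
  by rewrite subsetIl cardsD (uniformP _ _ H_unif) // ei.
by rewrite sumr_const -[_ *+ _]mulr_natl ler_wpM2r ?codeg_le.
Qed.

End GlueWeight.

(** * Sparse samples *)

Section Regime.
Variable R : realFieldType.
Implicit Types (k M N : nat) (a d p : R).

Definition growth_factor k M d : R := 2 * k%:R * (k * M)%:R ^+ k * d.

(* The value that makes the last estimate of [weight_dense_unions_le] sharp. *)
Definition sparsity_threshold k M d : R :=
  32 * k%:R * M%:R * (k * M)%:R ^+ k * d ^+ 3 * growth_factor k M d ^+ M.

Definition mean_degree k d : R := d / (4 * k%:R * k.+1%:R).

(* [p] is the sampling probability: a sample of [N] vertices has about [p * N]
   vertices, and its degrees are of order [mean_degree k d]. *)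
Record sampling_regime k M N d p : Prop := SamplingRegime {
  regime_k_ge4 : (4 <= k)%N;
  regime_M_gt0 : (0 < M)%N;
  regime_d_ge : 4 * k%:R * k.+1%:R <= d;
  regime_p_gt0 : 0 < p;
  regime_rate : p ^+ (k - 1) * N%:R ^+ (k - 3) = mean_degree k d;
  regime_size : sparsity_threshold k M d ^+ 2 <= p * N%:R
}.

Lemma mean_degree_ge1 k d :
  (0 < k)%N -> 4 * k%:R * k.+1%:R <= d -> 1 <= mean_degree k d.
Proof.
by move=> k_gt0 d_ge; rewrite ler_pdivlMr ?mul1r // !mulr_gt0 ?ltr0n.
Qed.

Lemma sample_size_pow k N a p : (3 <= k)%N ->
  p ^+ (k - 1) * N%:R ^+ (k - 3) = a ->
  (p * N%:R) ^+ (k - 1) = N%:R ^+ 2 * a.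
Proof.
move=> k_ge3 <-; rewrite exprMn; have {2}-> : (k - 1 = (k - 3) + 2)%N by lia.
by rewrite exprD; ring.
Qed.

Variables (k M N : nat) (d p : R).
Hypothesis regime : sampling_regime k M N d p.
Local Notation s := (p * N%:R).
Local Notation w := ((k * M)%:R : R).
Local Notation a := (mean_degree k d).
Local Notation tau := (sparsity_threshold k M d).

Let k_ge4 : (4 <= k)%N := regime_k_ge4 regime.
Let M_gt0 : (0 < M)%N := regime_M_gt0 regime.
Let p_gt0 : 0 < p := regime_p_gt0 regime.
Let kR_ge4 : 4 <= k%:R :> R. Proof. by rewrite (ler_nat R 4). Qed.
Let kS_ge1 : 1 <= k.+1%:R :> R. Proof. by rewrite ler1n. Qed.
Let w_ge1 : 1 <= w.
Proof. by rewrite ler1n muln_gt0 M_gt0 (leq_trans _ k_ge4). Qed.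
Let wk_ge1 : 1 <= w ^+ k. Proof. exact: exprn_ege1. Qed.

Let a_ge1 : 1 <= a.
Proof.
by rewrite mean_degree_ge1 ?(regime_d_ge regime) // (leq_trans _ k_ge4).
Qed.

Lemma mulS_mean_degree : k.+1%:R * a = d / (4 * k%:R).
Proof.
have [k_neq0 kS_neq0] : k%:R != 0 :> R /\ k.+1%:R != 0 :> R.
  by rewrite !pnatr_eq0 -lt0n (leq_trans _ k_ge4).
rewrite /mean_degree; move: k.+1%:R kS_neq0 => kS kS_neq0.
by field; rewrite k_neq0 kS_neq0.
Qed.

Lemma mulS_mean_degree_le : k.+1%:R * a <= d.
Proof.
have d_ge0 : 0 <= d by apply: le_trans (regime_d_ge regime); rewrite !mulr_ge0.
have k_ge1 : 1 <= 4 * k%:R :> R by have := kR_ge4; lra.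
rewrite mulS_mean_degree ler_pdivrMr ?(lt_le_trans ltr01 k_ge1) //.
by rewrite ler_peMr.
Qed.

Lemma mean_degree_le : a <= d.
Proof.
apply: le_trans mulS_mean_degree_le; rewrite ler_peMl //.
exact: le_trans ler01 a_ge1.
Qed.

Lemma regime_d_ge1 : 1 <= d.
Proof. exact: le_trans a_ge1 mean_degree_le. Qed.

Lemma growth_factor_ge1 : 1 <= growth_factor k M d.
Proof.
apply: mulr_ege1 regime_d_ge1; apply: mulr_ege1 wk_ge1.
by have := kR_ge4; lra.
Qed.

Lemma sparsity_threshold_ge : d <= tau.
Proof.
have d_ge1 := regime_d_ge1; have d_ge0 := le_trans ler01 d_ge1.
have -> : tau =
    32 * k%:R * M%:R * w ^+ k * d ^+ 2 * growth_factor k M d ^+ M * d.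
  by rewrite /sparsity_threshold; ring.
have kM_ge1 : 1 <= 32 * k%:R * M%:R :> R.
  by apply: mulr_ege1; [have := kR_ge4; lra | rewrite ler1n].
rewrite ler_peMl //; apply: mulr_ege1; last exact/exprn_ege1/growth_factor_ge1.
by do 2!apply: mulr_ege1 => //; exact: exprn_ege1.
Qed.

Lemma sparsity_threshold_ge1 : 1 <= tau.
Proof. exact: le_trans regime_d_ge1 sparsity_threshold_ge. Qed.

Lemma threshold_le_size : tau <= s.
Proof.
apply: le_trans (regime_size regime); rewrite expr2 ler_peMl //.
  exact: le_trans ler01 sparsity_threshold_ge1.
exact: sparsity_threshold_ge1.
Qed.

Lemma regime_size_ge1 : 1 <= s.
Proof. exact: le_trans sparsity_threshold_ge1 threshold_le_size. Qed.

Lemma edge_weight : N%:R ^+ (k - 2) * p ^+ k = s * a.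
Proof.
rewrite -(regime_rate regime).
have -> : (k - 2 = (k - 3).+1)%N by move: k_ge4; clear; lia.
have {2}-> : (k = (k - 1).+1)%N by move: k_ge4; clear; lia.
by rewrite !exprS; ring.
Qed.

Lemma codegree_weight i : (1 <= i <= k - 2)%N ->
  N%:R ^+ (k - 2 - i) * p ^+ (k - i) * s ^+ (i - 1) = a.
Proof.
move=> ik; rewrite -(regime_rate regime) exprMn.
have -> : (k - 1 = (k - i) + (i - 1))%N by move: k_ge4 ik; clear; lia.
have -> : (k - 3 = (k - 2 - i) + (i - 1))%N by move: k_ge4 ik; clear; lia.
by rewrite !exprD; ring.
Qed.

Lemma rate_mul_threshold_le : p * tau <= d.
Proof.
have s_ge1 := regime_size_ge1; have d_ge1 := regime_d_ge1.
have tau_ge0 : 0 <= tau := le_trans ler01 sparsity_threshold_ge1.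
have p_ge0 : 0 <= p by exact: ltW.
have d_ge0 : 0 <= d by exact: le_trans d_ge1.
rewrite -(ler_pXn2r (n := 2%N)) ?nnegrE ?(mulr_ge0 p_ge0 tau_ge0) // exprMn.
apply: (@le_trans _ _ (p ^+ 2 * s ^+ (k - 3))).
  rewrite ler_wpM2l ?exprn_ge0 //; apply: le_trans (regime_size regime) _.
  rewrite -[leLHS]expr1 ler_weXn2l //; move: k_ge4; clear; lia.
have /codegree_weight : (1 <= k - 2 <= k - 2)%N by move: k_ge4; clear; lia.
rewrite subnn expr0 mul1r -subnDA subKn; last by move: k_ge4; clear; lia.
move=> ->; apply: le_trans mean_degree_le _.
by rewrite expr2 ler_peMl.
Qed.

Lemma rate_le1 : p <= 1.
Proof.
have d_gt0 : 0 < d := lt_le_trans ltr01 regime_d_ge1.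
rewrite -(ler_pM2r d_gt0) mul1r; apply: le_trans rate_mul_threshold_le.
by rewrite ler_wpM2l ?(ltW p_gt0) ?sparsity_threshold_ge.
Qed.

End Regime.

Section OmittingWeights.
Variables (R : realFieldType) (T : finType) (H : {set {set T}}) (k M : nat).
Variables (d p : R).
Hypothesis regime : sampling_regime k M #|T| d p.
Hypothesis H_unif : uniform k H.
Hypothesis H_omit :
  {in H &, forall e f : {set T}, e != f -> (#|e :&: f| != k - 2)%N}.
Implicit Types (e S W : {set T}).

Local Notation n := (#|T|%:R : R).
Local Notation s := (p * n).
Local Notation w := ((k * M)%:R : R).
Local Notation tau := (sparsity_threshold k M d).
Let k_ge4 : (4 <= k)%N := regime_k_ge4 regime.
Let k_ge3 : (3 <= k)%N := ltnW k_ge4.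
Let p_gt0 : 0 < p := regime_p_gt0 regime.
Let p_ge0 : 0 <= p := ltW p_gt0.
Let d_gt0 : 0 < d := lt_le_trans ltr01 (regime_d_ge1 regime).
Let d_ge0 : 0 <= d := ltW d_gt0.
Let s_ge0 : 0 <= s. Proof. by rewrite mulr_ge0. Qed.
Let k_gt0 : 0 < k%:R :> R. Proof. by rewrite ltr0n (leq_trans _ k_ge4). Qed.
Let w_ge1 : 1 <= w.
Proof. by rewrite ler1n muln_gt0 (regime_M_gt0 regime) (leq_trans _ k_ge4). Qed.
Let wk_ge0 : 0 <= w ^+ k. Proof. by rewrite exprn_ge0. Qed.
Let tau_gt0 : 0 < tau := lt_le_trans ltr01 (sparsity_threshold_ge1 regime).

Definition codegree_cap : R := 2 * d / p.

Let cap_gt0 : 0 < codegree_cap. Proof. by rewrite divr_gt0 ?mulr_gt0. Qed.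
Let cap_mul_p : codegree_cap * p = 2 * d. Proof. by rewrite divfK ?gt_eqF. Qed.

Lemma weight_edges_le : weight p H <= s * d / (4 * k%:R).
Proof.
rewrite (weight_uniform _ H_unif).
rewrite -mulrA -(mulS_mean_degree regime) mulrCA -(edge_weight regime) mulrA.
rewrite ler_wpM2r ?exprn_ge0 //.
have := codegree_le k_ge3 H_unif H_omit (A := set0);
  rewrite cards0 subn0 => /(_ isT).
have -> : codegree H set0 = #|H|.
  by rewrite /codegree; apply: eq_card => e; rewrite inE sub0set andbT.
by rewrite -natrX -natrM ler_nat.
Qed.

Definition large_codegree :=
  [set S : {set T} | #|S| == (k - 1)%N & codegree_cap < (codegree H S)%:R].

Lemma weight_large_codegree_le : weight p large_codegree <= s / 8.
Proof.
have large_unif : uniform (k - 1) large_codegree.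
  by apply/uniformP => S; rewrite inE => /andP[/eqP].
rewrite (weight_uniform _ large_unif) -(ler_pM2r (_ : 0 < 2 * d)) ?mulr_gt0 //.
have -> : #|large_codegree|%:R * p ^+ (k - 1) * (2 * d) =
    #|large_codegree|%:R * codegree_cap * p ^+ k.
  have {2}-> : (k = (k - 1).+1)%N by move: k_ge4; clear; lia.
  by rewrite -cap_mul_p exprS; ring.
have large_le := card_large_codegree (k - 1)%N codegree_cap H_unif.
apply: le_trans (ler_wpM2r (exprn_ge0 k p_ge0) large_le) _.
rewrite bin_sub ?(leq_trans _ k_ge4) // bin1 natrM -[leLHS]mulrA.
rewrite -(weight_uniform p H_unif).
apply: le_trans (ler_wpM2l (ltW k_gt0) weight_edges_le) _.
suff -> : k%:R * (s * d / (4 * k%:R)) = s / 8 * (2 * d) by [].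
by field; rewrite gt_eqF.
Qed.

Definition trimmed :=
  [set e in H | [forall S in large_codegree, ~~ (S \subset e)]].

Lemma trimmed_sub : trimmed \subset H.
Proof. by apply/subsetP => e; rewrite inE => /andP[]. Qed.

Lemma trimmed_induced (A : {set T}) :
  {in large_codegree, forall S, ~~ (S \subset A)} -> H ::&: A = trimmed ::&: A.
Proof.
move=> largeA; apply/setP => e; rewrite !inE; case: (e \in H) => //=.
case: (boolP (e \subset A)) => eA; rewrite ?andbF // andbT.
by apply/esym/forall_inP => S /largeA; apply: contra => /subset_trans; apply.
Qed.

Lemma codegree_trimmed_le S : #|S| = (k - 1)%N ->
  (codegree trimmed S)%:R <= codegree_cap.
Proof.
move=> cardS; rewrite leNgt; apply/negP => cap_lt.
have large_S : S \in large_codegree.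
  rewrite inE cardS eqxx (lt_le_trans cap_lt) //.
  by rewrite ler_nat codegreeS // trimmed_sub.
suff star_empty : [set e in trimmed | S \subset e] = set0.
  by move: cap_lt; rewrite /codegree star_empty cards0 ltNge (ltW cap_gt0).
apply/setP => e; rewrite !inE; apply/negP => /andP[/andP[_ /forall_inP free]].
by apply/negP; exact: free.
Qed.

Section BoundedCodegree.
Hypothesis codegree_le_cap :
  forall S, #|S| = (k - 1)%N -> (codegree H S)%:R <= codegree_cap.

Section Union.
Variable W : {set T}.
Hypothesis card_W : (#|W| <= k * M)%N.
Local Notation meet_sum P := (\sum_(e in H | P #|e :&: W|) p ^+ #|e :\: W|).

Lemma meet_sum_le i (x y : R) : (i <= k)%N -> 0 <= x -> x * p ^+ (k - i) <= y ->
  (forall S, #|S| = i -> (codegree H S)%:R <= x) ->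
    meet_sum (pred1 i) <= w ^+ k * y.
Proof.
move=> ik x0 xy codeg_le.
apply: le_trans (sum_meet_card_le p_ge0 H_unif _ x0 codeg_le) _.
apply: ler_pM => //; rewrite ?exprn_ge0 ?mulr_ge0 ?exprn_ge0 //.
apply: (@le_trans _ _ (w ^+ i)); last exact: ler_weXn2l.
by rewrite lerXn2r ?nnegrE ?ler_nat.
Qed.

Lemma meet_sum_low i : (1 <= i <= k - 3)%N ->
  meet_sum (pred1 i) <= w ^+ k * (d / s ^+ (i - 1)).
Proof.
move=> ik; have s_gt0 := lt_le_trans ltr01 (regime_size_ge1 regime).
apply: (@meet_sum_le i (k.+1%:R * n ^+ (k - 2 - i))).
- by move: ik; clear; lia.
- by rewrite mulr_ge0 ?exprn_ge0.
- rewrite ler_pdivlMr ?exprn_gt0 // -!mulrA [n ^+ _ * _]mulrA.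
  rewrite (codegree_weight regime); last by move: ik; clear; lia.
  exact: mulS_mean_degree_le regime.
- move=> S cardS; rewrite -natrX -natrM ler_nat -cardS.
  by apply: codegree_le => //; rewrite cardS; case/andP: ik.
Qed.

Lemma meet_sum_middle : meet_sum (pred1 (k - 2)%N) <= w ^+ k * (4 * d * p).
Proof.
apply: (@meet_sum_le _ (2 * codegree_cap)) => [|||S cardS].
- exact: leq_subr.
- by rewrite mulr_ge0 // ltW.
- rewrite subKn ?(leq_trans _ k_ge4) // expr2.
  have -> : 2 * codegree_cap * (p * p) = 2 * (codegree_cap * p) * p by ring.
  by rewrite cap_mul_p mulrA -natrM.
- exact: (codegree_le_double k_ge3 H_unif H_omit (ltW cap_gt0)).
Qed.

Lemma meet_sum_top : meet_sum (pred1 (k - 1)%N) <= w ^+ k * (2 * d).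
Proof.
apply: meet_sum_le codegree_le_cap; rewrite ?leq_subr ?(ltW cap_gt0) //.
by rewrite subKn ?(leq_trans _ k_ge4) // expr1 cap_mul_p.
Qed.

Lemma sparse_meet_sum_le : meet_sum (sparse_meet k) <= growth_factor k M d.
Proof.
have -> : growth_factor k M d = k%:R * (w ^+ k * (2 * d)).
  by rewrite /growth_factor; ring.
apply: (ler_sum_level (h := fun e => #|e :&: W|) (P := sparse_meet k)).
- by move=> e; rewrite exprn_ge0.
- by rewrite !mulr_ge0.
- by move=> i /orP[]/eqP ->; move: k_ge4; clear; lia.
move=> i /orP[]/eqP ->; last exact: meet_sum_top.
have one_le : (1 <= 1 <= k - 3)%N by move: k_ge4; clear; lia.
apply: le_trans (meet_sum_low one_le) _.
by rewrite subnn expr0 divr1 ler_wpM2l // ler_peMl // ler1n.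
Qed.

Lemma dense_meet_sum_le :
  meet_sum (dense_meet k) <= k%:R * (w ^+ k * (4 * d ^+ 2 / tau)).
Proof.
have d2_ge : d <= 4 * d ^+ 2 by have := regime_d_ge1 regime; nra.
apply: (ler_sum_level (h := fun e => #|e :&: W|) (P := dense_meet k)).
- by move=> e; rewrite exprn_ge0.
- by rewrite !mulr_ge0 ?exprn_ge0 ?invr_ge0 ?(ltW tau_gt0).
- by rewrite /dense_meet => i /=; clear; lia.
move=> i /andP[i2 ik].
have [ik3|->] : (i <= k - 3)%N \/ i = (k - 2)%N by move: ik; clear; lia.
- apply: le_trans (meet_sum_low _) _; first by rewrite ik3 ltnW.
  have s_ge1 := regime_size_ge1 regime.
  rewrite ler_wpM2l // ler_pM ?invr_ge0 ?exprn_ge0 //.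
  rewrite lef_pV2 ?posrE ?exprn_gt0 //.
    apply: le_trans (threshold_le_size regime) _.
    by rewrite -[leLHS]expr1 ler_weXn2l //; move: i2; clear; lia.
  exact: lt_le_trans ltr01 s_ge1.
- apply: le_trans meet_sum_middle _; rewrite ler_wpM2l // ler_pdivlMr //.
  have -> : 4 * d ^+ 2 = 4 * d * d by ring.
  rewrite -[leLHS]mulrA; apply: ler_wpM2l; first exact: mulr_ge0.
  exact: rate_mul_threshold_le regime.
Qed.

End Union.

Lemma weight_sparse_unions_le j : (j <= M)%N ->
  weight p (sparse_unions H k j) <= growth_factor k M d ^+ j * (s * d).
Proof.
have growth_ge0 := le_trans ler01 (growth_factor_ge1 regime).
elim: j => [|j IH] jM.
  rewrite expr0 mul1r; apply: le_trans weight_edges_le _.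
  rewrite ler_pdivrMr ?mulr_gt0 // ler_peMr ?mulr_ge0 //.
  by rewrite -natrM ler1n muln_gt0 (leq_trans _ k_ge4).
rewrite /sparse_unions iterS exprS -mulrA.
apply: le_trans (ler_wpM2l growth_ge0 (IH (ltnW jM))).
apply: weight_glue => // W /(card_sparse_union H_unif) card_W.
by apply: sparse_meet_sum_le; rewrite (leq_trans card_W) // leq_mul2l jM orbT.
Qed.

Lemma weight_dense_unions_le j : (j < M)%N ->
  weight p (dense_unions H k j) <= s / (8 * M%:R).
Proof.
move=> jM; have M_neq0 : M%:R != 0 :> R.
  by rewrite pnatr_eq0 -lt0n (leq_trans _ jM).
set eps := k%:R * (w ^+ k * (4 * d ^+ 2 / tau)); set B := growth_factor k M d.
have eps_ge0 : 0 <= eps.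
  by rewrite !mulr_ge0 ?exprn_ge0 ?invr_ge0 ?(ltW tau_gt0).
apply: (@le_trans _ _ (eps * (B ^+ M * (s * d)))).
  apply: (@le_trans _ _ (eps * weight p (sparse_unions H k j))).
    apply: weight_glue => // W /(card_sparse_union H_unif) card_W.
    apply: dense_meet_sum_le.
    by rewrite (leq_trans card_W) // leq_mul2l jM orbT.
  rewrite ler_wpM2l //; apply: le_trans (weight_sparse_unions_le (ltnW jM)) _.
  apply: ler_wpM2r; first exact: mulr_ge0.
  by apply: ler_weXn2l (ltnW jM); exact: growth_factor_ge1 regime.
have tau_neq0 : tau != 0 by rewrite gt_eqF.
have -> : s / (8 * M%:R) = tau / tau * s / (8 * M%:R) by rewrite divff ?mul1r.
suff <- : eps * (B ^+ M * (s * d)) = tau / tau * s / (8 * M%:R) by [].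
rewrite {1}/sparsity_threshold /eps -/B; move: tau tau_neq0 => x x_neq0.
by field; rewrite M_neq0 x_neq0.
Qed.

End BoundedCodegree.

End OmittingWeights.

Section SparseSubset.
Variables (R : realFieldType) (T : finType) (H : {set {set T}}) (k M : nat).
Variables (d p : R).
Hypothesis regime : sampling_regime k M #|T| d p.
Hypothesis H_unif : uniform k H.
Hypothesis H_omit :
  {in H &, forall e f : {set T}, e != f -> (#|e :&: f| != k - 2)%N}.

Local Notation s := (p * #|T|%:R).
Let k_ge4 : (4 <= k)%N := regime_k_ge4 regime.
Let k_ge3 : (3 <= k)%N := ltnW k_ge4.
Let p_ge0 : 0 <= p := ltW (regime_p_gt0 regime).
Let d_gt0 : 0 < d := lt_le_trans ltr01 (regime_d_ge1 regime).
Local Notation G := (trimmed H k d p).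
Let GH : {subset G <= H} := subsetP (trimmed_sub H k d p).
Let G_unif : uniform k G := uniformS (trimmed_sub H k d p) H_unif.

Definition forbidden_sets : {set {set T}} :=
  large_codegree H k d p :|: \bigcup_(j < M) dense_unions G k j.

Lemma set0_notin_forbidden : set0 \notin forbidden_sets.
Proof.
rewrite !inE cards0 negb_or; apply/andP; split.
  by rewrite negb_and; apply/orP; left; apply/eqP; move: k_ge4; clear; lia.
apply/bigcupP => -[j _ /imset2P[W e _]]; rewrite inE => /andP[eG _] /esym/eqP.
rewrite setU_eq0 -[e == _]cards_eq0 (uniformP _ _ G_unif e eG)
  => /andP[_ /eqP k0].
by move: k_ge4; rewrite k0.
Qed.

Lemma weight_forbidden_le : weight p forbidden_sets <= s / 4.
Proof.
have pX_ge0 (W : {set T}) : 0 <= p ^+ #|W| by exact: exprn_ge0.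
have -> : s / 4 = s / 8 + s / 8 by field.
apply: le_trans (ler_sum_setU _ _ pX_ge0) _; apply: lerD.
  exact: weight_large_codegree_le regime H_unif H_omit.
apply: le_trans (ler_sum_bigcup _ _ pX_ge0) _.
apply: (@le_trans _ _ (\sum_(j < M) s / (8 * M%:R))).
  apply: ler_sum => j _; apply: (weight_dense_unions_le regime G_unif) => //.
    by move=> e f /GH eH /GH; exact: H_omit.
  by move=> S; exact: (codegree_trimmed_le H regime).
rewrite sumr_const card_ord -[_ *+ M]mulr_natr.
suff -> : s / (8 * M%:R) * M%:R = s / 8 by [].
by field; rewrite pnatr_eq0 -lt0n (regime_M_gt0 regime).
Qed.

Lemma forbidden_free_acyclic (A : {set T}) :
  {in forbidden_sets, forall W : {set T}, ~~ (W \subset A)} ->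
  acyclic_upto (H ::&: A) (eclass H k) M.
Proof.
move=> A_free; rewrite (@trimmed_induced _ _ H k d p); last first.
  by move=> S S_large; apply: A_free; rewrite inE S_large.
apply: (dense_free_acyclic k_ge4 G_unif).
- by move=> e f /GH eH /GH; exact: eclass_neq_meet.
- move=> e f /GH eH /GH fH ef; rewrite -card_gt0.
  apply: leq_trans (eclass_meet k_ge3 H_unif H_omit eH fH ef).
  by move: k_ge4; clear; lia.
- move=> j W jM Wj; apply: A_free; rewrite inE; apply/orP; right.
  by apply/bigcupP; exists (Ordinal jM).
Qed.

Lemma exists_sparse_subset : exists A : {set T},
  [/\ s / 2 <= #|A|%:R, {in A, forall v, (degree (H ::&: A) v)%:R <= d} &
      acyclic_upto (H ::&: A) (eclass H k) M].
Proof.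
have [A [A_free A_deg A_card]] :=
  exists_sparse_sample p_ge0 (rate_le1 regime) d_gt0 H_unif
    set0_notin_forbidden.
exists A; split=> //; last exact: forbidden_free_acyclic.
apply: le_trans A_card.
have edges_le : k%:R / d * weight p H <= s / 4.
  apply: (@le_trans _ _ (k%:R / d * (s * d / (4 * k%:R)))).
    by rewrite ler_wpM2l ?divr_ge0 ?(ltW d_gt0) // (weight_edges_le regime).
  suff -> : k%:R / d * (s * d / (4 * k%:R)) = s / 4 by [].
  by field; rewrite (gt_eqF d_gt0) pnatr_eq0 -lt0n (leq_trans _ k_ge4).
by have := weight_forbidden_le; lra.
Qed.

End SparseSubset.

(** * Choice of the parameters *)

Lemma powR_div_natK (R : realType) (x y : R) (m : nat) : (0 < m)%N ->
  (x `^ (y / m%:R)) ^+ m = x `^ y.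
Proof.
by move=> m0; rewrite -powR_mulrn ?powR_ge0 // -powRrM divfK // pnatr_eq0 -lt0n.
Qed.

Definition gain_constant (R : realType) (k : nat) : R :=
  8 * k%:R * k.+1%:R * 5 ^+ (k - 1).

Section TargetDegree.
Variables (R : realType) (k Q : nat).
Hypothesis k_ge4 : (4 <= k)%N.
Hypothesis Q_ge : (160 * k <= Q)%N.
Local Notation q := (Q%:R : R).

(* The degree [d] for which [2 * d * (5 / Q) ^+ (k - 1)] is [ln (Q / 4)]: a
   vertex then stays unblocked with probability at least [4 / Q]. *)
Definition target_degree : R := ln (q / 4) / 2 * (q / 5) ^+ (k - 1).
Local Notation d := target_degree.

Let kR_ge4 : 4 <= k%:R :> R. Proof. by rewrite (ler_nat R 4). Qed.
Let q_ge : 160 * k%:R <= q. Proof. by rewrite -natrM ler_nat. Qed.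
Let q_ge640 : 640 <= q. Proof. by have := kR_ge4; have := q_ge; lra. Qed.
Let q_ge1 : 1 <= q. Proof. by have := q_ge640; lra. Qed.

Lemma ln_quarter_rounds_ge : 2^-1 <= ln (q / 4).
Proof.
have q0 : 0 < q by have := q_ge640; lra.
have inv_le : 4 / q <= 2^-1 by rewrite ler_pdivrMr //; have := q_ge640; lra.
have inv_gt0 : 0 < 4 / q by rewrite divr_gt0.
have : ln (1 + (4 / q - 1)) <= 4 / q - 1 by apply: le_ln1Dx; lra.
by rewrite addrC subrK -[4 / q]invf_div lnV ?posrE ?divr_gt0 // invf_div; lra.
Qed.

Lemma target_degree_le : d <= q ^+ k.
Proof.
have [qR ln_ge] := (q_ge640, ln_quarter_rounds_ge).
have {1}-> : (k = (k - 1).+1)%N by move: k_ge4; clear; lia.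
rewrite exprS /target_degree; apply: ler_pM.
- by lra.
- by rewrite exprn_ge0 //; lra.
- have : ln (q / 4) < q / 4 by apply: ln_sublinear; lra.
  by lra.
- by rewrite lerXn2r ?nnegrE; lra.
Qed.

Lemma target_degree_ge : 4 * k%:R * k.+1%:R <= d.
Proof.
have [qR ln_ge] := (q_ge640, ln_quarter_rounds_ge).
have [kR kqR] := (kR_ge4, q_ge).
have q5k : (32 * k%:R) ^+ 2 <= (q / 5) ^+ 2 by rewrite lerXn2r ?nnegrE; lra.
have pow_le : (q / 5) ^+ 2 <= (q / 5) ^+ (k - 1).
  by apply: ler_weXn2l; [lra | move: k_ge4; clear; lia].
apply: (@le_trans _ _ (4^-1 * (q / 5) ^+ 2)).
  have k_le_sq : k%:R <= k%:R * k%:R :> R by rewrite ler_peMl //; lra.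
  by rewrite -[k.+1%:R]natr1; move: q5k; rewrite !expr2; lra.
rewrite /target_degree.
apply: ler_pM pow_le; rewrite ?invr_ge0 ?exprn_ge0 ?divr_ge0 //.
by lra.
Qed.

Let d_ge0 : 0 <= d.
Proof. by apply: le_trans target_degree_ge; rewrite !mulr_ge0. Qed.

Lemma target_degree_greedy : 2 < q * expR (- (2 * d * (5 / q) ^+ (k - 1))).
Proof.
have qR := q_ge640; have q0 : q != 0 by rewrite gt_eqF //; lra.
have -> : 2 * d * (5 / q) ^+ (k - 1) = ln (q / 4).
  rewrite /target_degree -mulrA -mulrA -exprMn.
  have -> : q / 5 * (5 / q) = 1 by field.
  by rewrite expr1n mulr1; field.
rewrite expRN lnK; last by rewrite posrE; lra.
have -> : q * (q / 4)^-1 = 4 by field.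
by lra.
Qed.

Lemma mean_target_degree :
  mean_degree k d / q ^+ (k - 1) = ln (q / 4) / gain_constant R k.
Proof.
have k_neq0 : k%:R != 0 :> R by rewrite pnatr_eq0 -lt0n (leq_trans _ k_ge4).
have kS_neq0 : k.+1%:R != 0 :> R by rewrite pnatr_eq0.
have qk_neq0 : q ^+ (k - 1) != 0.
  by rewrite expf_neq0 // gt_eqF // (lt_le_trans ltr01 q_ge1).
have fivek_neq0 : 5 ^+ (k - 1) != 0 :> R by rewrite expf_neq0 // pnatr_eq0.
rewrite /mean_degree /target_degree /gain_constant expr_div_n.
move: (q ^+ (k - 1)) qk_neq0 (5 ^+ (k - 1)) fivek_neq0 k.+1%:R kS_neq0.
move=> x x_neq0 y y_neq0 z z_neq0.
by field; rewrite x_neq0 y_neq0 z_neq0 k_neq0.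
Qed.

Let w_pow_le : (k * Q.*2)%:R ^+ k <= q ^+ (2 * k).
Proof.
rewrite exprM lerXn2r ?nnegrE ?exprn_ge0 // -natrX ler_nat.
by move: k_ge4 Q_ge; clear; nia.
Qed.

Let growth_ge0 : 0 <= growth_factor k Q.*2 d.
Proof. by rewrite mulr_ge0 // !mulr_ge0 ?exprn_ge0. Qed.

Let lead_ge0 : 0 <= 32 * k%:R * Q.*2%:R * (k * Q.*2)%:R ^+ k :> R.
Proof. by rewrite !mulr_ge0 ?exprn_ge0. Qed.

Let threshold_ge0 : 0 <= sparsity_threshold k Q.*2 d.
Proof. by rewrite mulr_ge0 ?(mulr_ge0 lead_ge0) ?exprn_ge0. Qed.

Lemma growth_factor_le : growth_factor k Q.*2 d <= q ^+ (3 * k + 1).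
Proof.
have -> : (3 * k + 1 = 1 + 2 * k + k)%N by clear; lia.
rewrite exprD exprD expr1 /growth_factor; apply: ler_pM target_degree_le => //.
  by rewrite !mulr_ge0 ?exprn_ge0.
apply: ler_pM w_pow_le; rewrite ?mulr_ge0 ?exprn_ge0 //.
by have [? ?] := (q_ge, kR_ge4); lra.
Qed.

Lemma sparsity_threshold_le_pow :
  sparsity_threshold k Q.*2 d <= q ^+ (8 * k * Q).
Proof.
have k_le : 32 * k%:R * Q.*2%:R <= q ^+ 2.
  by rewrite -!natrM -natrX ler_nat; move: k_ge4 Q_ge; clear; nia.
have d_le : d ^+ 3 <= q ^+ (k * 3).
  by rewrite exprM lerXn2r ?nnegrE ?exprn_ge0 // target_degree_le.
have growth_le : growth_factor k Q.*2 d ^+ Q.*2 <= q ^+ ((3 * k + 1) * Q.*2).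
  by rewrite exprM lerXn2r ?nnegrE ?exprn_ge0 // growth_factor_le.
apply: (@le_trans _ _
    (q ^+ 2 * q ^+ (2 * k) * q ^+ (k * 3) * q ^+ ((3 * k + 1) * Q.*2))).
  apply: ler_pM growth_le; rewrite ?(mulr_ge0 lead_ge0) ?exprn_ge0 //.
  apply: ler_pM d_le; rewrite ?exprn_ge0 //.
  by apply: ler_pM w_pow_le; rewrite ?mulr_ge0 ?exprn_ge0.
by rewrite -!exprD; apply: ler_weXn2l => //; move: k_ge4 Q_ge; clear; nia.
Qed.

Lemma sparsity_threshold_le :
  sparsity_threshold k Q.*2 d <= expR (8 * k%:R * q ^+ 2).
Proof.
apply: le_trans sparsity_threshold_le_pow _.
apply: (@le_trans _ _ (expR q ^+ (8 * k * Q))); last first.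
  by rewrite -expRM_natl !natrM expr2 mulrA.
rewrite lerXn2r ?nnegrE ?expR_ge0 //.
by apply: le_trans (expR_ge1Dx q); lra.
Qed.

Definition sampling_rate (N : nat) : R :=
  (mean_degree k d / N%:R ^+ (k - 3)) `^ (1 / (k - 1)%:R).

Lemma sparsity_threshold_pow_le (N : nat) :
  0 < N%:R :> R -> 8 * k%:R ^+ 2 * q ^+ 2 <= ln (N%:R : R) ->
  sparsity_threshold k Q.*2 d ^+ (k - 1) <= N%:R.
Proof.
move=> N_gt0 lnN_ge.
apply: (@le_trans _ _ (expR (8 * k%:R * q ^+ 2) ^+ (k - 1))).
  by rewrite lerXn2r ?nnegrE ?expR_ge0 ?sparsity_threshold_le.
rewrite -expRM_natl -[leRHS]lnK ?posrE // ler_expR; apply: le_trans lnN_ge.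
have -> : 8 * k%:R ^+ 2 * q ^+ 2 = k%:R * (8 * k%:R * q ^+ 2) by ring.
by rewrite ler_wpM2r ?mulr_ge0 ?exprn_ge0 // ler_nat leq_subr.
Qed.

Lemma target_regime (N : nat) : 8 * k%:R ^+ 2 * q ^+ 2 <= ln (N%:R : R) ->
  sampling_regime k Q.*2 N d (sampling_rate N).
Proof.
set p := sampling_rate N => lnN_ge.
have exponent_gt0 : (0 < k - 1)%N by move: k_ge4; clear; lia.
have lnN_gt0 : 0 < ln (N%:R : R).
  apply: lt_le_trans lnN_ge; have [kR qR] := (kR_ge4, q_ge640).
  by rewrite !mulr_gt0 ?exprn_gt0 //; lra.
have N_gt0 : 0 < N%:R :> R.
  by rewrite ltNge; apply/negP => /ln0 lnN0; rewrite lnN0 ltxx in lnN_gt0.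
have a_ge1 : 1 <= mean_degree k d.
  by rewrite mean_degree_ge1 ?target_degree_ge // (leq_trans _ k_ge4).
have ratio_gt0 : 0 < mean_degree k d / N%:R ^+ (k - 3).
  by rewrite divr_gt0 ?exprn_gt0 // (lt_le_trans ltr01).
have p_gt0 : 0 < p by exact: powR_gt0.
have rate : p ^+ (k - 1) * N%:R ^+ (k - 3) = mean_degree k d.
  rewrite powR_div_natK // powRr1 ?(ltW ratio_gt0) //.
  by rewrite divfK // gt_eqF ?exprn_gt0.
have Q_gt0 : (0 < Q.*2)%N.
  by rewrite double_gt0 (leq_trans _ Q_ge) // muln_gt0 (leq_trans _ k_ge4).
split=> //; first exact: target_degree_ge.
have pN_ge0 : 0 <= p * N%:R by rewrite mulr_ge0 ?(ltW p_gt0).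
rewrite -(ler_pXn2r exponent_gt0) ?nnegrE ?exprn_even_ge0 //.
rewrite (sample_size_pow (ltnW k_ge4) rate) exprAC.
apply: (@le_trans _ _ (N%:R ^+ 2)); last by rewrite ler_peMr ?exprn_ge0.
by rewrite lerXn2r ?nnegrE ?exprn_ge0 ?sparsity_threshold_pow_le.
Qed.

End TargetDegree.

Lemma independent_set_pow_ge (R : realType) (k Q n : nat) (T : finType)
    (H : {set {set T}}) :
  (4 <= k)%N -> (160 * k <= Q)%N -> omitting_system n k (k - 2) H ->
  8 * k%:R ^+ 2 * Q%:R ^+ 2 <= ln (n%:R : R) ->
  exists2 S : {set T}, independent H S &
    n%:R ^+ 2 * ln (Q%:R / 4) / gain_constant R k <= (2 * #|S|%:R) ^+ (k - 1).
Proof.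
move=> k_ge4 Qk /omitting_systemP[<- H_unif H_omit] lnT_ge.
have k_ge3 := ltnW k_ge4.
have Q_ge20 : (20 <= Q)%N by move: k_ge4 Qk; clear; lia.
have Q_gt0 : 0 < Q%:R :> R by rewrite ltr0n (leq_trans _ Q_ge20).
have regime := target_regime k_ge4 Qk lnT_ge.
set p := sampling_rate R k Q #|T| in regime.
have [A [A_card A_deg A_acyclic]] := exists_sparse_subset regime H_unif H_omit.
have subH : H ::&: A \subset H by apply/subsetP => e; rewrite inE => /andP[].
have [|S [SA S_indep S_card]] :=
  greedy_independent Q_ge20 k_ge3 (uniformS subH H_unif) _ A_acyclic
  A_deg (target_degree_greedy R k_ge4 Qk).
  by move=> e f /(subsetP subH) eH /(subsetP subH); exact: eclass_meet.
exists S; first exact: independent_induced SA S_indep.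
have s_ge0 : 0 <= p * #|T|%:R.
  by rewrite mulr_ge0 // ltW // (regime_p_gt0 regime).
have sample_le : p * #|T|%:R / Q%:R <= 2 * #|S|%:R.
  rewrite ler_pdivrMr //.
  by move: S_card A_card; rewrite -(ler_nat R) natrM; lra.
have ratio_ge0 : 0 <= p * #|T|%:R / Q%:R by rewrite divr_ge0.
apply: le_trans (_ : (p * #|T|%:R / Q%:R) ^+ (k - 1) <= _); last first.
  by rewrite lerXn2r ?nnegrE // (le_trans ratio_ge0).
rewrite expr_div_n (sample_size_pow k_ge3 (regime_rate regime)) -mulrA.
by rewrite -(mean_target_degree R k_ge4 Qk) mulrA.
Qed.

Lemma exists_rounds (R : realType) (k : nat) (L : R) : (4 <= k)%N ->
  (3 * k%:R * (160 * k + 1)%:R) ^+ 2 <= L -> exists Q : nat,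
    [/\ (160 * k <= Q)%N, 8 * k%:R ^+ 2 * Q%:R ^+ 2 <= L &
        0 <= ln L <= 4 * ln (Q%:R / 4)].
Proof.
move=> k_ge4 L_ge; have kR_ge4 : 4 <= k%:R :> R by rewrite (ler_nat R 4).
have k3_gt0 : 0 < 3 * k%:R :> R by lra.
have L_ge1 : 1 <= L.
  apply: le_trans L_ge; rewrite exprn_ege1 // mulr_ege1 //; first lra.
  by rewrite ler1n addn1.
pose y := Num.sqrt L / (3 * k%:R).
have y_ge0 : 0 <= y by rewrite divr_ge0 ?sqrtr_ge0 // ltW.
have LE : L = (3 * k%:R * y) ^+ 2.
  by rewrite /y mulrC divfK ?gt_eqF // sqr_sqrtr // (le_trans ler01 L_ge1).
have y_ge : (160 * k + 1)%:R <= y.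
  rewrite -(ler_pM2l k3_gt0) -(@ler_pXn2r _ 2%N) ?nnegrE //;
    rewrite ?(mulr_ge0 (ltW k3_gt0)) //.
  by rewrite -LE.
have /andP[Q_le Q_gt] := truncn_itv y_ge0; set Q := Num.truncn y in Q_le Q_gt.
have Qk : (160 * k <= Q)%N.
  rewrite -ltnS -(ltr_nat R) (lt_trans _ Q_gt) // (lt_le_trans _ y_ge) //.
  by rewrite ltr_nat addn1.
have Q_ge640 : 640 <= Q%:R :> R.
  by rewrite (ler_nat R 640); move: k_ge4 Qk; clear; lia.
have QR_ge : 160 * k%:R <= Q%:R :> R by rewrite -natrM ler_nat.
exists Q; split; rewrite ?ln_ge0 //=.
  rewrite LE exprMn; apply: ler_pM; rewrite ?mulr_ge0 ?exprn_ge0 //.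
    by rewrite exprMn ler_wpM2r ?exprn_ge0 // -natrX ler_nat.
  by rewrite lerXn2r ?nnegrE.
have Q4_gt0 : 0 < Q%:R / 4 :> R by lra.
rewrite mulr_natl -lnXn // ler_ln ?posrE ?exprn_gt0
  ?(lt_le_trans ltr01 L_ge1) //.
rewrite LE (exprM _ 2 2) lerXn2r ?nnegrE ?exprn_ge0 ?(mulr_ge0 (ltW k3_gt0))
  ?(ltW Q4_gt0) //.
apply: (@le_trans _ _ (3 * k%:R * (2 * Q%:R))); last by rewrite expr2; nra.
by rewrite ler_pM2l //; move: Q_gt; rewrite -natr1; lra.
Qed.

Lemma exists_ln_ge (R : realType) (x : R) :
  exists n0 : nat, forall n : nat, (n0 <= n)%N -> x <= ln (n%:R : R).
Proof.
exists (Num.truncn (expR x)).+1 => n n0n.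
have expx_le : expR x <= n%:R.
  by apply: le_trans (ltW (truncnS_gt _)) _; rewrite ler_nat.
by rewrite -ler_expR lnK // posrE; exact: lt_le_trans (expR_gt0 x) expx_le.
Qed.

Definition independence_rate (R : realType) (k n : nat) : R :=
  n%:R `^ (2 / (k - 1)%:R) * ln (ln n%:R) `^ (1 / (k - 1)%:R).

Lemma independence_rate_ge0 (R : realType) k n : 0 <= independence_rate R k n.
Proof. by rewrite mulr_ge0 ?powR_ge0. Qed.

Lemma independence_rate_pow (R : realType) (k n : nat) :
  (1 < k)%N -> 0 <= ln (ln (n%:R : R)) ->
  independence_rate R k n ^+ (k - 1) = n%:R ^+ 2 * ln (ln n%:R).
Proof.
move=> k_gt1 lnln_ge0; rewrite exprMn !powR_div_natK ?subn_gt0 //.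
by rewrite powR_mulrn // powRr1.
Qed.

Lemma exists_independent_set (R : realType) (k : nat) : (4 <= k)%N ->
  exists (c : R) (n0 : nat), 0 < c /\
    forall n, (n0 <= n)%N -> forall (T : finType) (H : {set {set T}}),
      omitting_system n k (k - 2) H -> exists S : {set T},
        independent H S /\ c * independence_rate R k n <= #|S|%:R.
Proof.
move=> k_ge4; have exponent_gt0 : (0 < k - 1)%N by move: k_ge4; clear; lia.
have k_gt1 : (1 < k)%N by apply: leq_trans k_ge4.
have gain_gt0 : 0 < gain_constant R k.
  by rewrite !mulr_gt0 ?exprn_gt0 ?ltr0n // (leq_trans _ k_ge4).
pose K := (gain_constant R k * 4)^-1; pose c := K `^ (1 / (k - 1)%:R).
have K_gt0 : 0 < K by rewrite invr_gt0 mulr_gt0.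
have [n0 lnn_ge] := exists_ln_ge ((3 * k%:R * (160 * k + 1)%:R) ^+ 2 : R).
exists (c / 2), n0; split=> [|n n0n T H H_omit].
  by rewrite divr_gt0 ?powR_gt0.
have [Q [Qk Qn /andP[lnln_ge0 lnln_le]]] := exists_rounds k_ge4 (lnn_ge n n0n).
have [S S_indep S_card] := independent_set_pow_ge k_ge4 Qk H_omit Qn.
exists S; split=> //; rewrite mulrAC ler_pdivrMr // [leRHS]mulrC.
have rate_ge0 := independence_rate_ge0 R k n.
rewrite -(ler_pXn2r exponent_gt0) ?nnegrE ?mulr_ge0 ?powR_ge0 //.
apply: le_trans S_card; rewrite exprMn independence_rate_pow //.
rewrite powR_div_natK // powRr1 ?(ltW K_gt0) // mulrC /K invfM mulrCA mulrC.
rewrite ler_pM2r ?invr_gt0 // -mulrA ler_wpM2l ?exprn_ge0 //.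
by rewrite ler_pdivrMr // mulrC.
Qed.

Theorem theorem1p2 (R : realType) (k : nat) (hk : (4 <= k)%N) :
  exists (c : R) (n0 : nat), 0 < c /\
    forall n : nat, (n0 <= n)%N ->
      (forall (T : finType) (H : {set {set T}}),
         omitting_system n k (k - 2) H ->
         exists S : {set T}, independent H S /\
           c * (n%:R `^ (2 / (k - 1)%:R) * ln (ln n%:R) `^ (1 / (k - 1)%:R))
             <= #|S|%:R)
      /\ c * (n%:R `^ (2 / (k - 1)%:R) * ln (ln n%:R) `^ (1 / (k - 1)%:R))
           <= (g n k (k - 2))%:R.
Proof.
have [c [n0 [c_gt0 exists_S]]] := exists_independent_set R hk.
exists c, n0; split=> // n n0n; split; first exact: exists_S.
have [[H H_omit ->] _] := g_spec n k (k - 2).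
have [S [S_indep S_ge]] := exists_S n n0n _ H H_omit.
by apply: le_trans S_ge _; rewrite ler_nat; exact: leq_bigmax_cond.
Qed.
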